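(* Let $p\in K$, let $M$ be a parameterized Picard–Vessiot extension of $K$ for the equation $\delta^2Y-p\,\delta Y=0$, and let $\eta\in M$ satisfy $\delta^2\eta=p\,\delta\eta$ and $\delta\eta\neq 0$. Then $\eta$ is $\partial$-transcendental over $K$ if and only if both of the following hold: (1) the equation $\delta Y=\partial p$ has no solution $Y\in K$; (2) the equation $\delta Y+pY=1$ has no solution $Y\in K$.
   Context: All fields have characteristic zero. A $\Delta$-field is a field with a finite set $\Delta$ of pairwise commuting derivations. A $\partial$-field $F$ is differentially closed ($\partial$-closed) if every system of polynomial differential equations over $F$ that has a solution in some $\partial$-field extension of $F$ already has a solution in $F$. Let $F$ be a differentially closed $\partial$-field. Let $K:=F(x)$, made into a $\Delta=\{\delta,\partial\}$-field by $\delta x=1$, $\partial x=0$, $\delta|_F=0$, with $\partial$ on $F$ the given derivation; then $K^\delta=F$. An element $y$ of a $\Delta$-field extension of $K$ is $\partial$-transcendental over $K$ if $y,\partial y,\partial^2y,\dots$ are algebraically independent over $K$. For a linear equation $\delta^nY+\sum_{i<n}r_i\delta^iY=0$ with $r_i\in K$, a parameterized Picard–Vessiot (PPV) extension is a $\Delta$-field extension $M\supseteq K$ such that: there are $n$ solutions $y_1,\dots,y_n\in M$ that are linearly independent over $K^\delta$; $M$ is generated as a $\Delta$-field over $K$ by $y_1,\dots,y_n$ (i.e., by all their iterated $\delta$- and $\partial$-derivatives); and $M^\delta=K^\delta$. *)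

(* Defs.v *)
From HB Require Import structures.
From mathcomp Require Import all_boot all_order all_algebra.
Set Implicit Arguments. Unset Strict Implicit. Unset Printing Implicit Defensive.
Import Order.TTheory GRing.Theory Num.Theory.
Local Open Scope ring_scope.

Definition derivation (R : pzRingType) (d : R -> R) : Prop :=
  (forall a b, d (a + b) = d a + d b) /\ (forall a b, d (a * b) = d a * b + a * d b).

(* Differential polynomials over F in the unknowns Y_0, Y_1, ...:
   DVar i j stands for the j-th derivative of Y_i. *)
Inductive dpoly (F : Type) : Type :=
| DConst of F
| DVar of nat & nat
| DAdd of dpoly F & dpoly F
| DMul of dpoly F & dpoly F
| DOpp of dpoly F.

Fixpoint deval (F : Type) (L : pzRingType) (phi : F -> L) (dL : L -> L)
   (a : nat -> L) (P : dpoly F) : L :=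
  match P with
  | DConst c => phi c
  | DVar i j => iter j dL (a i)
  | DAdd P Q => deval phi dL a P + deval phi dL a Q
  | DMul P Q => deval phi dL a P * deval phi dL a Q
  | DOpp P => - deval phi dL a P
  end.

Fixpoint all_vanish (F : Type) (L : pzRingType) (phi : F -> L) (dL : L -> L)
   (a : nat -> L) (sys : seq (dpoly F)) : Prop :=
  match sys with
  | [::] => True
  | P :: sys' => deval phi dL a P = 0 /\ all_vanish phi dL a sys'
  end.

Definition diff_closed (F : fieldType) (dF : F -> F) : Prop :=
  forall (sys : seq (dpoly F)),
    (exists (L : fieldType) (dL : L -> L) (phi : {rmorphism F -> L}),
        derivation dL /\ (forall c, phi (dF c) = dL (phi c)) /\
        exists a : nat -> L, all_vanish phi dL a sys) ->
    exists a : nat -> F, all_vanish id dF a sys.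

Definition ratfun (F : fieldType) := {fraction {poly F}}.
Local Notation "x %:F" := (@FracField.tofrac _ x).

Definition deltaK (F : fieldType) (f : ratfun F) : ratfun F :=
  let r := repr f in
  let n := \n_r in let d := \d_r in
  ((n^`())%:F * d%:F - n%:F * (d^`())%:F) / (d%:F) ^+ 2.

Definition partialK (F : fieldType) (dF : F -> F) (f : ratfun F) : ratfun F :=
  let r := repr f in
  let n := \n_r in let d := \d_r in
  let dp (q : {poly F}) := \poly_(i < size q) dF q`_i in
  ((dp n)%:F * d%:F - n%:F * (dp d)%:F) / (d%:F) ^+ 2.

Definition Delta_ext (F : fieldType) (dF : F -> F) (M : fieldType)
  (dM pM : M -> M) (phi : {rmorphism ratfun F -> M}) : Prop :=
  [/\ derivation dM, derivation pM, (forall m, dM (pM m) = pM (dM m)),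
      (forall f, phi (deltaK f) = dM (phi f)) &
      (forall f, phi (partialK dF f) = pM (phi f))].

Definition is_PPV_ext (F : fieldType) (dF : F -> F) (M : fieldType)
  (dM pM : M -> M) (phi : {rmorphism ratfun F -> M}) (p : ratfun F) : Prop :=
  exists y1 y2 : M,
    [/\
        dM (dM y1) - phi p * dM y1 = 0 /\ dM (dM y2) - phi p * dM y2 = 0,
        (forall c1 c2 : ratfun F, deltaK c1 = 0 -> deltaK c2 = 0 ->
           phi c1 * y1 + phi c2 * y2 = 0 -> c1 = 0 /\ c2 = 0),
        (forall S : M -> Prop,
           (forall f, S (phi f)) -> S y1 -> S y2 ->
           (forall a b, S a -> S b -> S (a + b)) ->
           (forall a, S a -> S (- a)) ->
           (forall a b, S a -> S b -> S (a * b)) ->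
           (forall a, S a -> S (a^-1)) ->
           (forall a, S a -> S (dM a)) ->
           (forall a, S a -> S (pM a)) ->
           forall m, S m) &
        (forall m : M, dM m = 0 <-> exists c, deltaK c = 0 /\ m = phi c)].

Definition monomial (M : pzRingType) (n : nat) (y : nat -> M) (e : n.-tuple nat) : M :=
  \prod_(i < n) y i ^+ tnth e i.

Definition partial_transcendental (F : fieldType) (M : fieldType)
  (pM : M -> M) (phi : {rmorphism ratfun F -> M}) (y : M) : Prop :=
  forall (n : nat) (s : seq (n.-tuple nat)) (c : n.-tuple nat -> ratfun F),
    uniq s ->
    \sum_(e <- s) phi (c e) * monomial (fun i => iter i pM y) e = 0 ->
    forall e, e \in s -> c e = 0.

(* Main.v *)
Require Import Defs.
From HB Require Import structures.
From mathcomp Require Import all_boot all_order all_algebra.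
From mathcomp Require Import boolp ring zify.
Set Implicit Arguments. Unset Strict Implicit. Unset Printing Implicit Defensive.
Import GRing.Theory.
Local Open Scope ring_scope.

(* Write u = delta eta, v = del u / u and C for the constants, which lie in K;
   then delta u = p u and delta v = del p.

   If (1) or (2) fails, creative telescoping applies. The space of rational
   functions with poles in a fixed finite set, modulo the image of f |-> delta f
   + p f, is finite dimensional, by counting dimensions. If (1) fails then
   v lies in K, every del^i u is in K u, and some constant coefficient operator L
   satisfies L u = delta (g u) with g in K; so L eta - g u is in C and eta
   satisfies a differential equation over K. If (2) fails then eta = Y u + c with
   Y in K, and some L satisfies L (del p) in delta K, so L v is in K; this is
   a differential equation for u, hence for eta.

   Conversely let (1) and (2) hold. Then v is not in K(u), and comparing u-degrees
   shows that eta is not in E = K(u, v, del v, ...). Suppose that the del^i eta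
   are algebraically dependent over E. As in the Kolchin-Ostrowski theorem, some
   del^n eta + sum_(i < n) c_i del^i eta with constant c_i lies in E. Its delta is
   u times a polynomial with leading term v^n. Let E' be a subfield of E with
   E = E'(v), v not in E', and every del^i v in E' + C v. Differentiating
   n times with respect to v commutes with delta, and gives an element of E
   whose delta is n! u: hence eta is in E, a contradiction. *)

(** * Derivations of a field and their extensions to polynomials *)

Section Derivation.
Variables (M : fieldType) (d : M -> M).
Hypothesis dP : derivation d.

Lemma derD a b : d (a + b) = d a + d b. Proof. exact: dP.1. Qed.
Lemma derM a b : d (a * b) = d a * b + a * d b. Proof. exact: dP.2. Qed.

Lemma der0 : d 0 = 0.
Proof. by apply: (@addrI _ (d 0)); rewrite -derD !addr0. Qed.

Lemma der1 : d 1 = 0.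
Proof. by apply: (@addrI _ (d 1)); rewrite addr0 -{3}(mulr1 1) derM !mulr1 mul1r. Qed.

Lemma derN a : d (- a) = - d a.
Proof. by apply: (@addrI _ (d a)); rewrite -derD !subrr der0. Qed.

Lemma derB a b : d (a - b) = d a - d b.
Proof. by rewrite derD derN. Qed.

Lemma derMn a n : d (a *+ n) = d a *+ n.
Proof. by elim: n => [|n IHn]; rewrite ?der0 // !mulrS derD IHn. Qed.

Lemma der_nat n : d n%:R = 0.
Proof. by rewrite derMn der1 mul0rn. Qed.

Lemma derV a : d a^-1 = - d a / a ^+ 2.
Proof.
have [->|a0] := eqVneq a 0; first by rewrite invr0 der0 oppr0 mul0r.
have: d (a * a^-1) = 0 by rewrite divff // der1.
rewrite derM => /eqP; rewrite addrC addr_eq0 => /eqP e.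
by apply: (mulfI a0); rewrite e; field.
Qed.

Lemma der_div a b : b != 0 -> d (a / b) = (d a * b - a * d b) / b ^+ 2.
Proof. by move=> b0; rewrite derM derV; field. Qed.

Lemma der_exp a n : d (a ^+ n.+1) = a ^+ n * d a *+ n.+1.
Proof.
elim: n => [|n IHn]; first by rewrite !expr1 expr0 mul1r.
by rewrite exprS derM IHn mulrnAr mulrA -exprS [d a * _]mulrC -mulrS.
Qed.

Lemma der_sum (I : Type) (r : seq I) (P : pred I) (f : I -> M) :
  d (\sum_(i <- r | P i) f i) = \sum_(i <- r | P i) d (f i).
Proof. by apply: (big_morph d derD der0). Qed.

Lemma der_iterD n a b : iter n d (a + b) = iter n d a + iter n d b.
Proof. by elim: n => //= n ->; rewrite derD. Qed.

(** The derivation of [M[X]] that extends [d] and sends [X] to [h]. The cases of interest are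
    [h = c], for a primitive, and [h = c X], for an exponential. *)
Definition poly_der (h P : {poly M}) : {poly M} := map_poly d P + h * P^`().

Lemma coef_map_der (P : {poly M}) i : (map_poly d P)`_i = d P`_i.
Proof. by rewrite coef_map_id0 // der0. Qed.

Lemma horner_poly_der h P y : d y = h.[y] -> d P.[y] = (poly_der h P).[y].
Proof.
move=> dy; rewrite /poly_der; elim/poly_ind: P => [|P c IHP].
  by rewrite horner0 der0 deriv0 mulr0 addr0 map_poly0 horner0.
have -> : map_poly d (P * 'X + c%:P) = map_poly d P * 'X + (d c)%:P.
  apply/polyP=> i; rewrite coef_map_der !coefD !coefMX !coefC derD coef_map_der.
  by case: i => [|i]; rewrite ?der0.
rewrite derivD derivC derivM derivX addr0 !hornerE derD derM dy.
move: IHP; rewrite !hornerE => ->; ring.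
Qed.

Lemma coef_poly_derC c P i :
  (poly_der c%:P P)`_i = d P`_i + c * P`_i.+1 *+ i.+1.
Proof. by rewrite coefD coef_map_der coefCM coef_deriv mulrnAr. Qed.

Lemma coef_poly_derX c P i :
  (poly_der (c *: 'X) P)`_i = d P`_i + c * P`_i *+ i.
Proof.
rewrite coefD coef_map_der -scalerAl coefZ coefXM coef_deriv.
by case: i => [|i] /=; rewrite ?mulr0 ?mulr0n // mulrnAr.
Qed.

Lemma deriv_poly_derC c P : (poly_der c%:P P)^`() = poly_der c%:P P^`().
Proof.
apply/polyP=> i; rewrite coef_deriv !coef_poly_derC !coef_deriv derMn mulrnDl.
by rewrite mulrnAr -!mulrnA mulnC.
Qed.

Lemma poly_derC_lt c P : P \is monic -> (1 < size P)%N ->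
  (size (poly_der c%:P P) < size P)%N.
Proof.
move=> /monicP; rewrite lead_coefE => lP sP; rewrite -(prednK (ltnW sP)) ltnS.
apply/leq_sizeP => i; rewrite leq_eqVlt coef_poly_derC => /orP[/eqP <-|si].
  by rewrite lP der1 (prednK (ltnW sP)) nth_default // mulr0 mul0rn addr0.
have sPi : (size P <= i)%N by rewrite -(prednK (ltnW sP)).
by rewrite (nth_default _ sPi) (nth_default _ (leqW sPi)) der0 mulr0 mul0rn addr0.
Qed.

(** The derivation multiplies the top coefficient 1 by [c] times the degree; subtracting that
    multiple of [P] cancels it. *)
Lemma poly_derX_lt c P : P \is monic -> 
  (size (poly_der (c *: 'X) P - (c *+ (size P).-1) *: P)%R < size P)%N.
Proof.
move=> mP; have sP : (0 < size P)%N by rewrite size_poly_gt0 monic_neq0.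
move: mP => /monicP; rewrite lead_coefE => lP; rewrite -{2}(prednK sP) ltnS.
apply/leq_sizeP => i; rewrite leq_eqVlt coefB coefZ coef_poly_derX => /orP[/eqP <-|si].
  by rewrite lP der1 !mulr1 add0r subrr.
have sPi : (size P <= i)%N by rewrite -(prednK sP).
by rewrite (nth_default _ sPi) der0 !mulr0 mul0rn addr0 subr0.
Qed.

Section Subfield.
Variable E : divringClosed M.
Hypothesis dE : {homo d : x / x \in E}.

Lemma polyOver_poly_der h P : h \is a polyOver E -> P \is a polyOver E ->
  poly_der h P \is a polyOver E.
Proof.
move=> hE PE; rewrite rpredD ?rpredM ?polyOver_deriv //.
by apply/polyOverP => i; rewrite coef_map_der; apply/dE/(polyOverP PE).
Qed.

Lemma polyOver_lead P : P \is a polyOver E -> P != 0 ->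
  exists2 Q, Q \is a polyOver E &
    [/\ Q \is monic, size Q = size P & Q = (lead_coef P)^-1 *: P].
Proof.
move=> PE P0; exists ((lead_coef P)^-1 *: P).
  by rewrite polyOverZ // rpredV; apply/(polyOverP PE).
split=> //; last by rewrite size_scale // invr_eq0 lead_coef_eq0.
by rewrite monicE lead_coefZ mulVf // lead_coef_eq0.
Qed.
End Subfield.

End Derivation.

(** * Subfields generated by one or finitely many elements *)

Definition adjoin (M : fieldType) (E : divringClosed M) (y : M) : {pred M} :=
  [pred z | `[< exists A B, [/\ A \is a polyOver E, B \is a polyOver E,
                                B.[y] != 0 & z = A.[y] / B.[y]] >]].

Section Adjoin.
Variables (M : fieldType) (E : divringClosed M) (y : M).

Lemma adjoin_divring_closed : GRing.divring_closed (adjoin E y).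
Proof.
split.
- apply/asboolP; exists 1, 1; rewrite !rpred1 !hornerE oner_neq0.
  by split=> //; rewrite ?divr1 ?invr1.
- move=> _ _ /asboolP[A [B [AE BE B0 ->]]] /asboolP[C [D [CE DE D0 ->]]].
  apply/asboolP; exists (A * D - C * B), (B * D).
  rewrite rpredB ?rpredM // !hornerE mulf_neq0 //; split=> //.
  by field; rewrite B0 D0.
- move=> _ _ /asboolP[A [B [AE BE B0 ->]]] /asboolP[C [D [CE DE D0 ->]]].
  apply/asboolP; have [C0|C0] := eqVneq C.[y] 0.
    exists 0, 1; rewrite rpred0 rpred1 !hornerE oner_neq0; split=> //.
    by rewrite C0 mul0r invr0 mulr0.
  exists (A * D), (B * C); rewrite !rpredM // !hornerE mulf_neq0 //; split=> //.
  by field; rewrite B0 C0 D0.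
Qed.

HB.instance Definition _ :=
  GRing.isDivringClosed.Build M (adjoin E y) adjoin_divring_closed.

Lemma adjoin_gen : y \in adjoin E y.
Proof.
apply/asboolP; exists 'X, 1; rewrite polyOverX rpred1 !hornerE oner_neq0.
  by split=> //; rewrite ?divr1 ?invr1.
Qed.

Lemma sub_adjoin : {subset E <= adjoin E y}.
Proof.
move=> z zE; apply/asboolP; exists z%:P, 1.
rewrite polyOverC zE rpred1 !hornerE oner_neq0.
  by split=> //; rewrite ?divr1 ?invr1.
Qed.

Lemma adjoin_min (L : divringClosed M) :
  {subset E <= L} -> y \in L -> {subset adjoin E y <= L}.
Proof.
move=> EL yL _ /asboolP[A [B [AE BE B0 ->]]].
by rewrite rpred_div // rpred_horner // (polyOverS EL).
Qed.

(** The target [L] may exceed [adjoin E y]: a derivation that raises the order by one maps each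
    field of a tower of derivatives into the next. *)
Lemma adjoin_der_sub (d : M -> M) (L : divringClosed M) : derivation d ->
  {in E, forall x, d x \in L} -> {subset adjoin E y <= L} -> d y \in L ->
  {in adjoin E y, forall x, d x \in L}.
Proof.
move=> dP dE EL dy _ /asboolP[A [B [AE BE B0 ->]]].
have EL' : {subset E <= L} by move=> x /sub_adjoin/EL.
have H P : P \is a polyOver E -> P.[y] \in L.
  by move=> PE; rewrite rpred_horner ?EL ?adjoin_gen // (polyOverS EL').
have dH P : P \is a polyOver E -> d P.[y] \in L.
  move=> PE; rewrite (@horner_poly_der _ _ dP (d y)%:P) ?hornerC //.
  rewrite hornerD hornerM hornerC; apply: rpredD; last first.
    by apply: rpredM dy _; apply/H/polyOver_deriv.
  apply: rpred_horner; last exact/EL/adjoin_gen.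
  by apply/polyOverP => i; rewrite coef_map_der //; apply/dE/(polyOverP PE).
by rewrite der_div // rpred_div ?rpredX ?rpredB ?rpredM ?H ?dH.
Qed.

Lemma adjoin_der (d : M -> M) : derivation d -> {homo d : x / x \in E} ->
  d y \in adjoin E y -> {homo d : x / x \in adjoin E y}.
Proof.
move=> dP dE dy; apply: adjoin_der_sub => // x /dE; exact: sub_adjoin.
Qed.

End Adjoin.

Fixpoint adjoin_seq (M : fieldType) (E : divringClosed M) (y : nat -> M) n :
  divringClosed M := if n is m.+1 then adjoin (adjoin_seq E y m) (y m) else E.

Section AdjoinSeq.
Variables (M : fieldType) (E : divringClosed M) (y : nat -> M).

Lemma sub_adjoin_seq m n : (m <= n)%N ->
  {subset adjoin_seq E y m <= adjoin_seq E y n}.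
Proof.
move=> /subnK <-; elim: (n - m)%N => //= k IHk x /IHk; exact: sub_adjoin.
Qed.

Lemma adjoin_seq_gen i n : (i < n)%N -> y i \in adjoin_seq E y n.
Proof. by move=> /sub_adjoin_seq; apply; apply: adjoin_gen. Qed.

Lemma adjoin_seq_der (d : M -> M) : derivation d -> {homo d : x / x \in E} ->
  forall n, (forall i, (i < n)%N -> d (y i) \in E) ->
  {homo d : x / x \in adjoin_seq E y n}.
Proof.
move=> dP dE; elim=> //= n IHn dy; apply: adjoin_der => //.
  by apply: IHn => i /ltnW; apply: dy.
apply: sub_adjoin; apply: (@sub_adjoin_seq 0) => //; exact: dy.
Qed.
End AdjoinSeq.

(** * Adjunction of a primitive or of an exponential without new constants *)

Section SimpleExtension.
Variables (M : fieldType) (d : M -> M) (E : divringClosed M).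
Hypotheses (dP : derivation d) (char0 : forall n, n.+1%:R != 0 :> M).
Hypotheses (dE : {homo d : x / x \in E}) (cE : forall c, d c = 0 -> c \in E).

Lemma mulrSn_eq0 (x : M) n : x *+ n.+1 = 0 -> x = 0.
Proof.
by move=> /eqP; rewrite -mulr_natr mulf_eq0 (negPf (char0 n)) orbF => /eqP.
Qed.

Lemma size1_monic (P : {poly M}) : P \is monic -> (size P <= 1)%N -> P = 1.
Proof.
move=> mP /size1_polyC e; move: mP; rewrite e monicE lead_coefC => /eqP ->.
by rewrite polyC1.
Qed.

Section Primitive.
Variable y : M.
Hypotheses (yE : d y \in E) (yNE : y \notin E).

(** In degree [n], one below the top, the equation reads [d P_n + (n + 1) d y = 0]. So
    [y + P_n / (n + 1)] is a constant, which would put [y] in [E]. *)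
Lemma primitive_monic_const P : P \is a polyOver E -> P \is monic ->
  poly_der d (d y)%:P P = 0 -> P = 1.
Proof.
move=> PE mP DP; apply: size1_monic => //; rewrite leqNgt; apply: contra yNE => sP.
pose n := (size P).-2; have sPn : size P = n.+2 by move: sP; rewrite /n; case: (size P) => [|[]].
have lP : P`_n.+1 = 1 by move/monicP: mP; rewrite lead_coefE sPn.
have := congr1 (fun Q : {poly M} => Q`_n) DP.
rewrite /= (coef_poly_derC dP) lP mulr1 coef0 => e.
have /cE : d (y + P`_n / n.+1%:R) = 0.
  rewrite (derD dP) (der_div dP) ?char0 // (der_nat dP) mulr0 subr0.
  have -> : d P`_n = - (d y *+ n.+1) by apply/eqP; rewrite -addr_eq0 e.
  by rewrite -[d y *+ _]mulr_natr; move: (char0 n); move: n.+1%:R => c c0; field.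
move=> H; rewrite -[y](addrK (P`_n / n.+1%:R)) rpredB // rpred_div ?rpred_nat //.
exact: (polyOverP PE).
Qed.

(** Applying [poly_der] to a monic relation of [y] gives a relation of smaller degree, zero by
    induction; but then the monic relation is 1. *)
Lemma primitive_transc P : P \is a polyOver E -> P.[y] = 0 -> P = 0.
Proof.
have [m] := ubnP (size P); elim: m P => // m IHm P /[!ltnS] sP PE Py.
apply/eqP/negP => /negP P0; have [Q QE [mQ sQ eQ]] := polyOver_lead PE P0.
have Qy : Q.[y] = 0 by rewrite eQ hornerZ Py mulr0.
have Q1 : (1 < size Q)%N.
  rewrite ltnNge; apply/negP => /(size1_monic mQ) Q1.
  by move/eqP: Qy; rewrite Q1 hornerC oner_eq0.
have /IHm : (size (poly_der d (d y)%:P Q) < m)%N.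
  by apply: leq_trans sP; rewrite -sQ poly_derC_lt.
rewrite polyOver_poly_der ?polyOverC // -(horner_poly_der dP) ?hornerC // Qy (der0 dP).
move=> /(_ isT erefl) /(primitive_monic_const QE mQ) Q1'.
by rewrite Q1' size_poly1 in Q1.
Qed.

(* The least denominator of [z] is a constant for the derivation, hence 1. *)
Lemma primitive_integral z G : z \in adjoin E y -> G \is a polyOver E ->
  d z = G.[y] ->
  exists A, [/\ A \is a polyOver E, z = A.[y] & poly_der d (d y)%:P A = G].
Proof.
move=> zE GE dz; have [A AE zA] : exists2 A, A \is a polyOver E & z = A.[y].
  have {zE}/asboolP[A [B [AE BE By]]] := zE.
  have B0 : B != 0 by apply: contraNneq By => ->; rewrite horner0.
  move=> ez; have zA : z * B.[y] = A.[y] by rewrite ez divfK.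
  have [m] := ubnP (size B); elim: m A B AE BE B0 {By ez} zA => // m IHm A B AE BE B0 zA.
  rewrite ltnS => sB; have [Q QE [mQ sQ eQ]] := polyOver_lead BE B0.
  pose A' := (lead_coef B)^-1 *: A.
  have A'E : A' \is a polyOver E by rewrite polyOverZ // rpredV; apply/(polyOverP BE).
  have zQ : z * Q.[y] = A'.[y] by rewrite eQ !hornerZ -zA; ring.
  have [Q1|Q1] := leqP (size Q) 1.
    by exists A' => //; rewrite -zQ (size1_monic mQ Q1) hornerC mulr1.
  have QN0 : poly_der d (d y)%:P Q != 0.
    apply: contraTneq Q1 => /(primitive_monic_const QE mQ) ->.
    by rewrite size_poly1.
  apply: (IHm (poly_der d (d y)%:P A' - G * Q) _ _ _ QN0).
  (* The new pair comes from applying [d] to [z * Q.[y] = A'.[y]]; its denominator has smaller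
     degree. *)
  - by rewrite rpredB ?rpredM ?polyOver_poly_der ?polyOverC.
  - by rewrite polyOver_poly_der ?polyOverC.
  - rewrite -(horner_poly_der dP) ?hornerC // hornerD hornerN hornerM.
    rewrite -(horner_poly_der dP) ?hornerC // -zQ -dz (derM dP).
    by ring.
  - by apply: leq_trans sB; rewrite -sQ poly_derC_lt.
exists A; split=> //; apply/eqP; rewrite -subr_eq0; apply/eqP.
apply: primitive_transc; first by rewrite rpredB ?polyOver_poly_der ?polyOverC.
by rewrite hornerD hornerN -(horner_poly_der dP) ?hornerC // -zA dz subrr.
Qed.

(* Write z = A(y); the formal derivative d/dy commutes with the derivation, so
   d (A^(n)(y)) = G^(n)(y), which is a multiple of the top coefficient of G. *)
Lemma primitive_top_coef z G n : z \in adjoin E y -> G \is a polyOver E ->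
  (size G <= n.+1)%N -> d z = G.[y] ->
  exists2 z', z' \in adjoin E y & d z' = G`_n.
Proof.
move=> zE GE sG dz; have [A [AE _ DA]] := primitive_integral zE GE dz.
have DAn : poly_der d (d y)%:P A^`(n) = (G`_n *+ n`!)%:P.
  transitivity G^`(n).
    by rewrite -DA; elim: n {sG} => // n IHn; rewrite !derivnS -(deriv_poly_derC dP) IHn.
  apply/polyP=> i; rewrite coef_derivn coefC; case: i => [|i].
    by rewrite addn0 ffactnn.
  by rewrite nth_default ?mul0rn // (leq_trans sG) // addnS ltnS leq_addr.
have nf : n`!%:R != 0 :> M by rewrite -(prednK (fact_gt0 n)).
exists (A^`(n).[y] / n`!%:R).
  rewrite rpred_div ?rpred_nat // rpred_horner ?adjoin_gen //.
  by rewrite (polyOverS (sub_adjoin _)) // polyOver_derivn.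
rewrite (der_div dP) // (der_nat dP) (horner_poly_der dP (h := (d y)%:P)) ?hornerC // DAn.
by rewrite hornerC -mulr_natr; field.
Qed.

(** Write [z = A(y)]. The derivation commutes with [d/dX], so [A'(y)] is a constant; by
    transcendence [A'] is a constant polynomial and [A] is affine. *)
Lemma primitive_linear z : z \in adjoin E y -> d z \in E ->
  exists2 c, d c = 0 & z - c * y \in E.
Proof.
move=> zE dzE; have dz : d z = (d z)%:P.[y] by rewrite hornerC.
have GE : (d z)%:P \is a polyOver E by rewrite polyOverC.
have [A [AE zA DA]] := primitive_integral zE GE dz.
have dA' : d A^`().[y] = 0.
  rewrite (horner_poly_der dP (h := (d y)%:P)) ?hornerC // -(deriv_poly_derC dP) DA.
  by rewrite derivC horner0.
have eA' : A^`() = (A^`().[y])%:P.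
  apply/eqP; rewrite -subr_eq0; apply/eqP/primitive_transc; last first.
    by rewrite hornerD hornerN hornerC subrr.
  by rewrite rpredB ?polyOver_deriv // polyOverC cE.
exists A^`().[y] => //.
have -> : z = A`_0 + A^`().[y] * y; last by rewrite addrK; apply/(polyOverP AE).
rewrite zA; have -> : A.[y] = ((A`_0)%:P + A^`().[y] *: 'X).[y].
  congr (_.[y]); apply/polyP => i.
  rewrite coefD coefC coefZ coefX; case: i => [|[|i]] /=.
  - by rewrite mulr0 addr0.
  - by rewrite mulr1 add0r -[A`_1]mulr1n -coef_deriv {1}eA' coefC.
  - rewrite mulr0 addr0; apply: (@mulrSn_eq0 _ i.+1).
    by rewrite -coef_deriv eA' coefC.
by rewrite hornerD hornerC hornerZ hornerX.
Qed.
End Primitive.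

Section Exponential.
Variables (u p : M).
Hypotheses (pE : p \in E) (du : d u = p * u) (u0 : u != 0).
Hypothesis uNE : forall k, u ^+ k.+1 \notin E.

(** For [P] of degree [m], its value at [u] is [u^m d (P(u) / u^m)]; the correction term lowers the
    degree of a monic [P]. *)
Let D (P : {poly M}) := poly_der d (p *: 'X) P - (p *+ (size P).-1) *: P.

(** A nonzero coefficient [P_i], with [i + k + 1] the degree, would satisfy [d P_i = (k + 1) p P_i].
    Then [P_i / u^(k+1)] is a constant and [u^(k+1)] lies in [E]. *)
Lemma exp_monic P : P \is a polyOver E -> P \is monic ->
  D P = 0 -> P = 'X^((size P).-1).
Proof.
move=> PE mP DP; apply/polyP => i; rewrite coefXn.
have [->|] := eqVneq; first by move/monicP: mP; rewrite lead_coefE.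
rewrite neq_ltn => /orP[im|]; last first.
  by move=> mi; rewrite nth_default // -(@prednK (size P)) // size_poly_gt0 monic_neq0.
apply: contraTeq isT => Pi0; pose k := ((size P).-1 - i).-1.
have ek : (size P).-1 = (i + k.+1)%N.
  by rewrite /k prednK ?subn_gt0 // subnKC // ltnW.
have := congr1 (fun Q : {poly M} => Q`_i) DP.
rewrite /= coefB coefZ (coef_poly_derX dP) coef0 ek => e.
have /cE : d (P`_i / u ^+ k.+1) = 0.
  rewrite (der_div dP) ?expf_neq0 // (der_exp dP) du.
  have -> : d P`_i = p *+ k.+1 * P`_i.
    by apply/eqP; rewrite -subr_eq0; apply/eqP; rewrite -[RHS]e -mulrnAl mulrnDr; ring.
  rewrite exprS -[p *+ k.+1]mulr_natr -[_ * (p * u) *+ _]mulr_natr.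
  move: (u ^+ k) (expf_neq0 k u0) k.+1%:R => v v0 c.
  by field; rewrite u0 v0.
move=> H; have := uNE k; rewrite -[u ^+ k.+1](mulrVK (x := P`_i)) ?unitfE //.
rewrite -invf_div mulrC rpred_div //; apply/(polyOverP PE).
Qed.

Lemma exp_transc P : P \is a polyOver E -> P.[u] = 0 -> P = 0.
Proof.
have [m] := ubnP (size P); elim: m P => // m IHm P /[!ltnS] sP PE Py.
apply/eqP/negP => /negP P0; have [Q QE [mQ sQ eQ]] := polyOver_lead PE P0.
have Qy : Q.[u] = 0 by rewrite eQ hornerZ Py mulr0.
have DQE : D Q \is a polyOver E.
  rewrite rpredB ?polyOver_poly_der ?polyOverZ ?polyOverX //.
  by rewrite rpredMn.
have : (size (D Q) < m)%N.
  by apply: leq_trans sP; rewrite -sQ poly_derX_lt.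
move=> /IHm /(_ DQE) DQ; have {}DQ : D Q = 0.
  apply: DQ; rewrite /D hornerD hornerN hornerZ Qy mulr0 subr0 -(horner_poly_der dP).
    by rewrite Qy (der0 dP).
  by rewrite hornerZ hornerX.
move/eqP: Qy; rewrite (exp_monic QE mQ DQ) hornerXn expf_eq0 (negPf u0) andbF.
by [].
Qed.

(** [z] is a Laurent polynomial in [u], and the derivation maps [E u^i] into itself. Comparing the
    coefficients of [u^0] and [u^1] in [d z] gives the two equations. *)
Lemma exp_graded z a b : z \in adjoin E u -> a \in E -> b \in E ->
  d z = a + b * u ->
  (exists2 a', a' \in E & d a' = a) /\ (exists2 b', b' \in E & d b' + p * b' = b).
Proof.
move=> zE aE bE dz; pose G := a%:P + b *: 'X.
have GE : G \is a polyOver E by rewrite rpredD ?polyOverC ?polyOverZ ?polyOverX.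
have dzG : d z = G.[u] by rewrite hornerD hornerC hornerZ hornerX.
have uX : d u = (p *: 'X).[u] by rewrite hornerZ hornerX.
(* Descent on the denominator, ending when [D Q = 0], that is when [Q] is a power of [X]. *)
have [m [A AE zA]] : exists m, exists2 A, A \is a polyOver E & z * u ^+ m = A.[u].
  have {zE}/asboolP[A [B [AE BE By]]] := zE.
  have B0 : B != 0 by apply: contraNneq By => ->; rewrite horner0.
  move=> ez; have zA : z * B.[u] = A.[u] by rewrite ez divfK.
  have [m] := ubnP (size B); elim: m A B AE BE B0 {By ez} zA => // m IHm A B AE BE B0 zA.
  rewrite ltnS => sB; have [Q QE [mQ sQ eQ]] := polyOver_lead BE B0.
  have [A' A'E zQ] : exists2 A', A' \is a polyOver E & z * Q.[u] = A'.[u].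
    exists ((lead_coef B)^-1 *: A); last by rewrite eQ !hornerZ -zA; ring.
    by rewrite polyOverZ // rpredV; apply/(polyOverP BE).
  have [/(exp_monic QE mQ) eQX|QN0] := eqVneq (D Q) 0.
    by exists (size Q).-1, A' => //; rewrite -zQ {2}eQX hornerXn.
  apply: (IHm (poly_der d (p *: 'X) A' - (p *+ (size Q).-1) *: A' - G * Q) _ _ _ QN0).
  - rewrite !rpredB ?rpredM ?polyOver_poly_der ?polyOverZ ?polyOverX //.
    by rewrite rpredMn.
  - rewrite rpredB ?polyOver_poly_der ?polyOverZ ?polyOverX //.
    by rewrite rpredMn.
  - rewrite /D hornerD hornerN hornerZ -(horner_poly_der dP) // hornerD hornerN.
    by rewrite hornerM hornerD hornerN hornerZ -(horner_poly_der dP) // -zQ -dzG (derM dP); ring.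
  - by apply: leq_trans sB; rewrite -sQ poly_derX_lt.
have DA : poly_der d (p *: 'X) A - (p *+ m) *: A = G * 'X^m.
  apply/eqP; rewrite -subr_eq0; apply/eqP/exp_transc.
    rewrite !rpredB ?rpredM ?polyOver_poly_der ?polyOverZ ?polyOverX ?polyOverXn //.
    by rewrite rpredMn.
  rewrite hornerD hornerN hornerM hornerD hornerN hornerZ hornerXn.
  rewrite -(horner_poly_der dP) // -zA -dzG (derM dP).
  case: m {zA} => [|m]; first by rewrite expr0 (der1 dP); ring.
  by rewrite (der_exp dP) du exprS -mulr_natr -[p *+ _]mulr_natr; ring.
(* [G * 'X^m] has the coefficients [a] and [b] in degrees [m] and [m + 1]. *)
have cA i := congr1 (fun Q : {poly M} => Q`_(m + i)) DA.
split.
  exists A`_m; first exact: (polyOverP AE).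
  have := cA 0; rewrite /= addn0 coefB coefZ (coef_poly_derX dP) coefMXn ltnn subnn.
  rewrite coefD coefC coefZ coefX mulr0 addr0 => <-.
  by rewrite -[p * _ *+ _]mulr_natr -[p *+ _]mulr_natr; ring.
exists A`_m.+1; first exact: (polyOverP AE).
have := cA 1; rewrite /= addn1 coefB coefZ (coef_poly_derX dP) coefMXn ltnNge leqnSn.
rewrite subSnn /= coefD coefC coefZ coefX mulr1 add0r => <-.
by rewrite -[p * _ *+ _]mulr_natr -natr1 -[p *+ _]mulr_natr; ring.
Qed.
End Exponential.
End SimpleExtension.

(** * Towers of primitives and the Kolchin-Ostrowski argument *)

Section Tower.
Variables (M : fieldType) (d : M -> M) (E : divringClosed M) (y : nat -> M).
Hypotheses (dP : derivation d) (char0 : forall n, n.+1%:R != 0 :> M).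
Hypotheses (dE : {homo d : x / x \in E}) (cE : forall c, d c = 0 -> c \in E).

Lemma sub_base_adjoin_seq n : {subset E <= adjoin_seq E y n}.
Proof. exact: (@sub_adjoin_seq _ E y 0). Qed.

(** Peel off the last generator: [z] is affine in it with a constant slope, and the remainder lies
    one level lower. A generator already in the field below gets coefficient 0. *)
Lemma adjoin_seq_linear n z : (forall i, (i < n)%N -> d (y i) \in E) ->
  z \in adjoin_seq E y n -> d z \in E ->
  exists2 c : nat -> M, forall i, d (c i) = 0 &
    z - \sum_(i < n) c i * y i \in E.
Proof.
elim: n z => [|n IHn] z dy zE dz.
  by exists (fun=> 0) => [i|]; rewrite ?(der0 dP) // big_ord0 subr0.
have dy' i : (i < n)%N -> d (y i) \in E by move/ltnW/dy.
have [a da az] : exists2 a, d a = 0 & z - a * y n \in adjoin_seq E y n.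
  have [yE|yNE] := boolP (y n \in adjoin_seq E y n).
    exists 0; first exact: der0.
    by rewrite mul0r subr0; apply: adjoin_min yE _ zE.
  apply: (primitive_linear dP char0 _ _ _ yNE) => //.
  - exact: adjoin_seq_der.
  - by move=> c /cE /sub_base_adjoin_seq; apply.
  - by apply: sub_base_adjoin_seq; apply: dy.
  - exact: sub_base_adjoin_seq.
have [|c dc cz] := IHn _ dy' az.
  rewrite (derB dP) (derM dP) da mul0r add0r rpredB // rpredM ?dy //.
  exact: cE.
exists (fun i => if i == n then a else c i) => [i|]; first by case: ifP.
rewrite big_ord_recr /= eqxx.
under eq_bigr => i _ do rewrite ltn_eqF //.
by rewrite [X in _ - X]addrC opprD addrA.
Qed.

Lemma monomial_rcons n (t : n.-tuple nat) (j : nat) :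
  monomial y [tuple of rcons t j] = monomial y t * y n ^+ j.
Proof.
rewrite /monomial big_ord_recr /=; congr (_ * _ ^+ _).
  apply: eq_bigr => i _; congr (_ ^+ _).
  by rewrite !(tnth_nth 0%N) /= nth_rcons size_tuple ltn_ord.
by rewrite (tnth_nth 0%N) /= nth_rcons size_tuple ltnn eqxx.
Qed.

(** A relation is a polynomial in the last generator, which is transcendental over the field below;
    each of its coefficients is a relation among the earlier ones. *)
Lemma adjoin_seq_free n (s : seq (n.-tuple nat)) (c : n.-tuple nat -> M) :
  (forall i, (i < n)%N -> d (y i) \in E) ->
  (forall i, (i < n)%N -> y i \notin adjoin_seq E y i) ->
  uniq s -> (forall e, c e \in E) ->
  \sum_(e <- s) c e * monomial y e = 0 -> forall e, e \in s -> c e = 0.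
Proof.
elim: n s c => [|n IHn] s c dy yN us cEs.
  have allnil (e : 0.-tuple nat) : e = [tuple] by apply: tuple0.
  case: s us => [|a [|b s]] //=.
    rewrite big_seq1 /monomial big_ord0 mulr1 => _ ca e; rewrite inE => /eqP ->.
    exact: ca.
  by rewrite (allnil a) (allnil b) inE eqxx.
move=> s0 e es.
have dy' i : (i < n)%N -> d (y i) \in E by move/ltnW/dy.
have yN' i : (i < n)%N -> y i \notin adjoin_seq E y i by move/ltnW/yN.
have yE i : (i < n)%N -> y i \in adjoin_seq E y n by apply: adjoin_seq_gen.
pose init (f : n.+1.-tuple nat) := [tuple of belast (thead f) (behead f)].
pose top (f : n.+1.-tuple nat) := last (thead f) (behead f).
have ft f : f = [tuple of rcons (init f) (top f)].
  by apply: val_inj; rewrite /= -lastI [in LHS](tuple_eta f).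
pose P := \sum_(f <- s) (c f * monomial y (init f)) *: 'X^(top f).
have P0 : P = 0.
  apply: (@primitive_transc _ d (adjoin_seq E y n) _ _ _ _ (y n)) => //.
  - exact: adjoin_seq_der.
  - by move=> b /cE; apply: sub_base_adjoin_seq.
  - by apply: sub_base_adjoin_seq; apply: dy.
  - exact: yN.
  - apply: rpred_sum => f _; rewrite polyOverZ ?polyOverXn // rpredM //.
      exact: sub_base_adjoin_seq.
    by apply: rpred_prod => i _; rewrite rpredX // yE.
  - rewrite horner_sum -[RHS]s0; apply: eq_bigr => f _.
    have -> : monomial y f = monomial y (init f) * y n ^+ top f.
      by rewrite {1}(ft f) monomial_rcons.
    by rewrite hornerZ hornerXn mulrA.
have := congr1 (fun Q : {poly M} => Q`_(top e)) P0.
rewrite /= coef_sum coef0 => Ptop.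
(* The coefficient of degree [top e] retains the exponents that agree with [e] in the last place;
   removing that place keeps them distinct. *)
pose s' := [seq init f | f <- s & top f == top e].
pose c' (t : n.-tuple nat) := c [tuple of rcons t (top e)].
have cf f : top f == top e -> c' (init f) = c f.
  by move=> /eqP tf; rewrite /c' -tf -ft.
have us' : uniq s'.
  rewrite map_inj_in_uniq ?filter_uniq // => f g.
  rewrite !mem_filter => /andP[/eqP tf _] /andP[/eqP tg _] ifg.
  by rewrite (ft f) (ft g) ifg tf tg.
have s'0 : \sum_(f <- s') c' f * monomial y f = 0.
  rewrite big_map big_filter -[RHS]Ptop big_mkcond; apply: eq_bigr => f _.
  rewrite coefZ coefXn [top e == _]eq_sym; case: ifP => [tf|_]; last by rewrite mulr0.
  by rewrite mulr1 cf.
rewrite -cf //; apply: (IHn s' c' dy' yN' us' _ s'0) => [t|]; first exact: cEs.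
by apply: map_f; rewrite mem_filter eqxx.
Qed.
End Tower.

(** * Conditions (1) and (2) imply independence of the derivatives of [eta] *)

Section Independence.
Variables (M : fieldType) (d D : M -> M) (K : divringClosed M).
Hypotheses (dP : derivation d) (DP : derivation D).
Hypothesis dD : forall m, d (D m) = D (d m).
Hypothesis char0 : forall n, n.+1%:R != 0 :> M.
Hypotheses (dK : {homo d : x / x \in K}) (DK : {homo D : x / x \in K}).
Hypothesis cK : forall c, d c = 0 -> c \in K.
Variables (p eta : M).
Hypotheses (pK : p \in K) (dd_eta : d (d eta) = p * d eta) (u0 : d eta != 0).

Let u := d eta.
Let v i := iter i D (D u / u).

Lemma der_iter n z : d (iter n D z) = iter n D (d z).
Proof. by elim: n => //= n <-; rewrite dD. Qed.

Lemma iter_mem n z : z \in K -> iter n D z \in K.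
Proof. by move=> zK; elim: n => //= n; apply: DK. Qed.

Lemma der_logder : d (D u / u) = D p.
Proof. by rewrite (der_div dP) // dD dd_eta (derM DP) -/u; field. Qed.

Lemma der_v i : d (v i) = iter i.+1 D p.
Proof. by rewrite der_iter der_logder iterSr. Qed.

Lemma der_v_mem i : d (v i) \in K.
Proof. by rewrite der_v iter_mem. Qed.

(* Complete Bell polynomials in v 0, v 1, ... *)
Fixpoint bell i := if i is j.+1 then D (bell j) + v 0 * bell j else 1.

Lemma iter_bell i : iter i D u = bell i * u.
Proof.
elim: i => /= [|i ->]; first by rewrite mul1r.
by rewrite (derM DP) mulrDl /v /=; field.
Qed.

Lemma der_iter_eta i : d (iter i D eta) = bell i * u.
Proof. by rewrite der_iter iter_bell. Qed.

(* [degv k j z]: z is a polynomial over K of total degree at most k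
   in v 0, ..., v j.-1. *)
Inductive degv : nat -> nat -> M -> Prop :=
| degv_const k j a : a \in K -> degv k j a
| degv_var i j : (i < j)%N -> degv 1 j (v i)
| degv_add k j a b : degv k j a -> degv k j b -> degv k j (a + b)
| degv_mul k l j a b : degv k j a -> degv l j b -> degv (k + l) j (a * b)
| degv_le k l j a : (k <= l)%N -> degv k j a -> degv l j a.

Lemma degv_widen k j l a : (j <= l)%N -> degv k j a -> degv k l a.
Proof.
move=> + Ta; elim: Ta => {k j a} [k j a aK|i j ij|k j a b _ IHa _ IHb|
  k k' j a b _ IHa _ IHb|k k' j a kk' _ IHa] jl.
- exact: degv_const.
- by apply: degv_var; apply: leq_trans jl.
- by apply: degv_add; auto.
- by apply: degv_mul; auto.
- by apply: degv_le kk' _; auto.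
Qed.

Lemma degv_der k j a : degv k j a -> degv k j.+1 (D a).
Proof.
elim=> {k j a} [k j a aK|i j ij|k j a b _ IHa _ IHb|
  k k' j a b Ta IHa Tb IHb|k k' j a kk' _ IHa].
- by apply: degv_const; apply: DK.
- exact: (@degv_var i.+1).
- by rewrite (derD DP); apply: degv_add.
- rewrite (derM DP); apply: degv_add; apply: degv_mul => //.
    exact: degv_widen Tb.
  exact: degv_widen Ta.
- exact: degv_le kk' _.
Qed.

Lemma degv_expv n j : (0 < j)%N -> degv n j (v 0 ^+ n).
Proof.
move=> j0; elim: n => [|n IHn]; first by apply: degv_const; rewrite rpred1.
by rewrite exprS -add1n; apply: degv_mul => //; apply: degv_var.
Qed.

(** [D] does not raise the degree in the [v i] and multiplication by [v 0] raises it by one, so only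
    [v 0 ^+ n] attains degree [n]. For [n = 0] no lower degree exists, and the remainder is 0. *)
Lemma bell_lead n : exists2 t, bell n = v 0 ^+ n + t &
  if n is m.+1 then degv m n t else t = 0.
Proof.
elim: n => [|n [t /= -> Tt]]; first by exists 0 => //; rewrite expr0 addr0.
exists (D (v 0 ^+ n) + (D t + v 0 * t)).
  by rewrite -[D u / u]/(v 0) exprS (derD DP); ring.
case: n Tt => [|n] Tt.
  by rewrite Tt !expr0 (der1 DP) (der0 DP) mulr0 !addr0; apply: degv_const; rewrite rpred0.
apply: degv_add.
  by apply: degv_der; apply: degv_expv.
apply: degv_add; first by apply: degv_le (leqnSn n) _; apply: degv_der.
rewrite -add1n; apply: degv_mul; first exact: degv_var.
exact: degv_widen Tt.
Qed.

Lemma bell_deg n : degv n n (bell n).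
Proof.
have [t -> Tt] := bell_lead n; case: n Tt => [|n] Tt.
  by rewrite Tt addr0; apply: degv_const; rewrite rpred1.
apply: degv_add; first exact: degv_expv.
exact: degv_le (leqnSn n) _.
Qed.

Lemma degv_mem (L : divringClosed M) k j a : {subset K <= L} ->
  (forall i, (i < j)%N -> v i \in L) -> degv k j a -> a \in L.
Proof.
move=> KL + Ta; elim: Ta => {k j a} [k j a aK|i j ij|k j a b _ IHa _ IHb|
  k k' j a b _ IHa _ IHb|k k' j a kk' _ IHa] vL.
- exact: KL.
- exact: vL.
- by rewrite rpredD ?IHa ?IHb.
- by rewrite rpredM ?IHa ?IHb.
- exact: IHa.
Qed.

(** Replacing each [v i] by an expression affine in [v 0], with constant slope, does not raise the
    degree. *)
Lemma degv_horner (L : divringClosed M) k j a : {subset K <= L} ->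
  (forall i, (i < j)%N -> exists2 c, d c = 0 & v i - c * v 0 \in L) ->
  degv k j a -> exists G, [/\ G \is a polyOver L, (size G <= k.+1)%N & a = G.[v 0]].
Proof.
move=> KL + Ta; elim: Ta => {k j a} [k j a aK|i j ij|k j a b _ IHa _ IHb|
  k k' j a b _ IHa _ IHb|k k' j a kk' _ IHa] vL.
- exists a%:P; rewrite polyOverC KL // hornerC; split=> //.
  by rewrite (leq_trans (size_polyC_leq1 _)).
- have [c dc cL] := vL i ij; have cL' := KL c (cK dc); exists ((v i - c * v 0)%:P + c *: 'X).
  rewrite rpredD ?polyOverC ?polyOverZ ?polyOverX //; split=> //.
    rewrite (leq_trans (size_polyD _ _)) // geq_max (leq_trans (size_polyC_leq1 _)) //.
    by rewrite (leq_trans (size_scale_leq _ _)) // size_polyX.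
  by rewrite hornerD hornerC hornerZ hornerX; ring.
- have [G [GL sG ->]] := IHa vL; have [H [HL sH ->]] := IHb vL.
  exists (G + H); rewrite rpredD // hornerD; split=> //.
  by rewrite (leq_trans (size_polyD _ _)) // geq_max sG.
- have [G [GL sG ->]] := IHa vL; have [H [HL sH ->]] := IHb vL.
  exists (G * H); rewrite rpredM // hornerM; split=> //.
  rewrite (leq_trans (size_polyMleq _ _)) // -subn1 leq_subLR add1n -addSn -addnS.
  exact: leq_add.
- by have [G [GL sG ->]] := IHa vL; exists G; split=> //; apply: leq_trans sG _.
Qed.

Hypothesis no_log : forall Y, Y \in K -> d Y != D p.
Hypothesis no_exp : forall Y, Y \in K -> d Y + p * Y != 1.

(** [v 0] is the logarithmic [D]-derivative of [u^(k+1)] divided by [k + 1]; in [K] it would solve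
    [d Y = D p]. *)
Lemma u_power_notin k : u ^+ k.+1 \notin K.
Proof.
apply/negP => uK; have vK : v 0 \in K.
  have -> : v 0 = D (u ^+ k.+1) / u ^+ k.+1 / k.+1%:R.
    rewrite (der_exp DP) -[_ *+ k.+1]mulr_natr exprS /v /=.
    move: (char0 k) (expf_neq0 k u0); rewrite -/u.
    move: k.+1%:R (u ^+ k) => c w c0 w0.
    by field; rewrite c0 w0 u0.
  by rewrite rpred_div ?rpred_nat // rpred_div // DK.
by move/eqP: (no_log vK); rewrite der_v.
Qed.

Let Ku : divringClosed M := adjoin K u.

Lemma der_Ku : {homo d : x / x \in Ku}.
Proof.
apply: adjoin_der => //; rewrite dd_eta rpredM ?adjoin_gen //.
exact: sub_adjoin.
Qed.

Lemma const_Ku c : d c = 0 -> c \in Ku.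
Proof. by move/cK; apply: sub_adjoin. Qed.

Lemma logder_notin : v 0 \notin Ku.
Proof.
apply/negP => vKu.
have [|||[a aK da] _] := exp_graded dP dK cK pK dd_eta u0 u_power_notin vKu (a := D p) (b := 0).
- exact: DK.
- exact: rpred0.
- by rewrite der_v mul0r addr0.
by have := no_log aK; rewrite da eqxx.
Qed.

Let Kuv m := adjoin_seq Ku v m.

Lemma der_v_Ku i : d (v i) \in Ku.
Proof. by apply: sub_adjoin; apply: der_v_mem. Qed.

(** Otherwise [eta] minus a constant combination of the [v i] lies in [K(u)]. The derivative of this
    difference has coefficient 1 at [u], so its [u]-part solves [d Y + p Y = 1]. *)
Lemma eta_notin m : eta \notin Kuv m.
Proof.
apply/negP => eK.
have [||c dc] := adjoin_seq_linear dP char0 der_Ku const_Ku _ eK.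
- by move=> i _; apply: der_v_Ku.
- exact: adjoin_gen.
set z := eta - _ => zK.
have dz : d z = - (\sum_(i < m) c i * d (v i)) + 1 * u.
  rewrite (derB dP) (der_sum dP) mul1r addrC; congr (- _ + _).
  by apply: eq_bigr => i _; rewrite (derM dP) dc mul0r add0r.
have [||_ [b bK db]] := exp_graded dP dK cK pK dd_eta u0 u_power_notin zK _ _ dz.
- rewrite rpredN rpred_sum // => i _; by rewrite rpredM ?der_v_mem //; exact: cK.
- exact: rpred1.
by have := no_exp bK; rewrite db eqxx.
Qed.

(* Adjoin v 0, ..., v m.-1 to Ku one after the other, skipping those that would
   bring v 0 into the field; a skipped v i is affine in v 0. *)
Lemma subfield_avoiding_logder m : exists E : divringClosed M,
  [/\ {homo d : x / x \in E}, {subset Ku <= E}, {subset E <= Kuv m},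
      v 0 \notin E & forall i, (i < m)%N -> exists2 c, d c = 0 & v i - c * v 0 \in E].
Proof.
elim: m => [|m [E [dE KE EK vE hE]]].
  by exists Ku; split=> //; [exact: der_Ku | exact: logder_notin].
have cE c : d c = 0 -> c \in E by move/const_Ku/KE.
have EK' : {subset E <= Kuv m.+1} by move=> z /EK; apply: sub_adjoin.
have dvE i : d (v i) \in E by apply/KE/der_v_Ku.
have [v0E|v0E] := boolP (v 0 \in adjoin E (v m)); last first.
  exists (adjoin E (v m) : divringClosed M); split=> //.
  - by apply: adjoin_der => //; apply: sub_adjoin.
  - by move=> z /KE; apply: sub_adjoin.
  - by apply: adjoin_min => //; apply: adjoin_gen.
  - move=> i; rewrite ltnS leq_eqVlt => /orP[/eqP->|/hE[c dc cv]].
      by exists 0; [exact: der0 | rewrite mul0r subr0 adjoin_gen].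
    by exists c => //; apply: sub_adjoin.
have vmE : v m \notin E.
  by apply: contra vE => vmE; apply: adjoin_min vmE _ v0E.
exists E; split=> // i; rewrite ltnS leq_eqVlt => /orP[/eqP->|/hE//].
have [c dc cv] := primitive_linear dP char0 dE cE (dvE m) vmE v0E (dvE 0).
have c0 : c != 0 by apply: contraNneq vE => c0; rewrite c0 mul0r subr0 in cv.
exists c^-1; first by rewrite (derV dP) dc oppr0 mul0r.
have -> : v m - c^-1 * v 0 = - (c^-1 * (v 0 - c * v m)) by field.
by rewrite rpredN rpredM // rpredV cE.
Qed.

(** Over the subfield [E] that avoids [v 0], [d z] is a polynomial of degree [n] in [v 0] with top
    coefficient [u]. Hence some [w] in [E(v 0)] has [d w = u = d eta], and [eta] would lie in
    [Kuv m]. *)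
Lemma combination_notin n m (c : nat -> M) z : (n < m)%N ->
  (forall i, d (c i) = 0) -> d z = (bell n + \sum_(i < n) c i * bell i) * u ->
  z \notin Kuv m.
Proof.
move=> nm dc dz; apply/negP => zK; have [E [dE KE EK vE hE]] := subfield_avoiding_logder m.
have KE' : {subset K <= E} by move=> a aK; apply/KE/sub_adjoin.
have cE a : d a = 0 -> a \in E by move/const_Ku/KE.
have KvE : {subset Kuv m <= adjoin E (v 0)}.
  have : (m <= m)%N by []. 
  rewrite /Kuv; elim: {1 3}m => [_ a /KE|k IHk km]; first exact: sub_adjoin.
  apply: adjoin_min; first exact/IHk/ltnW.
  have [a da aE] := hE k km; rewrite -[v k](subrK (a * v 0)) rpredD //.
    exact: sub_adjoin.
  by rewrite rpredM ?adjoin_gen //; apply/sub_adjoin/cE.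
have [t Wn Tt] := bell_lead n.
(* The terms other than [v 0 ^+ n] have total degree below [n]; for [n = 0] they are absent. *)
have [G [GE sG tG]] : exists G, [/\ G \is a polyOver E, (size G <= n)%N &
    t + \sum_(i < n) c i * bell i = G.[v 0]].
  case: n Tt nm {dz Wn} => [->|n Tt nm].
    by exists 0; rewrite rpred0 size_poly0 big_ord0 addr0 horner0.
  apply: (@degv_horner E n n.+1) => //.
    by move=> i ni; apply: hE; apply: leq_trans nm; apply: ltnW.
  apply: degv_add => //; elim/big_ind: _ => [|a b|i _].
  - by apply: degv_const; rewrite rpred0.
  - exact: degv_add.
  - apply: (@degv_mul 0 n); first by apply: degv_const; apply: cK.
    have in' : (i <= n)%N by rewrite -ltnS.
    exact: (degv_le in' (degv_widen (leqW in') (bell_deg i))).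
have uE : u \in E by apply: KE; apply: adjoin_gen.
have dz' : d z = (u *: ('X^n + G)).[v 0].
  by rewrite dz Wn -addrA tG hornerZ hornerD hornerXn mulrC.
have [|||w wE dw] := primitive_top_coef dP char0 dE cE _ vE (KvE z zK) _ _ dz' (n := n).
- exact/KE/der_v_Ku.
- by rewrite polyOverZ // rpredD // polyOverXn.
- rewrite (leq_trans (size_scale_leq _ _)) // (leq_trans (size_polyD _ _)) //.
  by rewrite geq_max size_polyXn leqnn leqW.
have /const_Ku : d (eta - w) = 0.
  by rewrite (derB dP) dw coefZ coefD coefXn eqxx (nth_default _ sG) addr0 mulr1 subrr.
have mn0 : (0 < m)%N by apply: leq_trans nm.
have wK : w \in Kuv m.
  by apply: adjoin_min wE => //; apply: adjoin_seq_gen.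
move=> /(@sub_base_adjoin_seq _ _ v m) H; have /negP := eta_notin m; apply.
by rewrite -[eta](subrK w) rpredD.
Qed.

Lemma bell_mem n m : (n <= m)%N -> bell n \in Kuv m.
Proof.
move=> nm; apply: degv_mem (bell_deg n) => [a aK|i ni].
  exact/sub_base_adjoin_seq/sub_adjoin.
by apply: adjoin_seq_gen; apply: leq_trans nm.
Qed.

Let etas i := iter i D eta.

Lemma der_derivatives_mem i m : (i <= m)%N -> d (etas i) \in Kuv m.
Proof.
move=> im; rewrite der_iter_eta rpredM ?bell_mem //.
exact/sub_base_adjoin_seq/adjoin_gen.
Qed.

(** By the Kolchin-Ostrowski argument, membership would put a constant combination with leading term
    [etas n] in [Kuv m], which is excluded. *)
Lemma derivatives_notin n m : (n < m)%N -> etas n \notin adjoin_seq (Kuv m) etas n.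
Proof.
move=> nm; apply/negP => eK.
have dKv : {homo d : x / x \in Kuv m}.
  by apply: adjoin_seq_der => // [|i _]; [exact: der_Ku | exact: der_v_Ku].
have cKv c : d c = 0 -> c \in Kuv m by move/const_Ku; apply: sub_base_adjoin_seq.
have [||c dc] := adjoin_seq_linear dP char0 dKv cKv _ eK.
- by move=> i im; apply: der_derivatives_mem; apply: ltnW; apply: ltn_trans nm.
- by apply: der_derivatives_mem; apply: ltnW.
apply/negP; apply: (@combination_notin n m (fun i => - c i)) => // [i|].
  by rewrite (derN dP) dc oppr0.
rewrite (derB dP) (der_sum dP) der_iter_eta mulrDl mulr_suml -sumrN.
congr (_ + _); apply: eq_bigr => i _.
by rewrite (derM dP) dc mul0r add0r der_iter_eta !mulNr mulrA.
Qed.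

Lemma derivatives_free n (s : seq (n.-tuple nat)) (c : n.-tuple nat -> M) :
  uniq s -> (forall e, c e \in K) ->
  \sum_(e <- s) c e * monomial etas e = 0 -> forall e, e \in s -> c e = 0.
Proof.
move=> us cs s0.
have dKv : {homo d : x / x \in Kuv n}.
  by apply: adjoin_seq_der => // [|i _]; [exact: der_Ku | exact: der_v_Ku].
have cKv a : d a = 0 -> a \in Kuv n by move/const_Ku; apply: sub_base_adjoin_seq.
apply: (adjoin_seq_free dP char0 dKv cKv) us _ s0.
- by move=> i /ltnW; apply: der_derivatives_mem.
- by move=> i; apply: derivatives_notin.
- by move=> e; apply/sub_base_adjoin_seq/sub_adjoin/cs.
Qed.
End Independence.

(** * Linear dependence and degree bounds for polynomials *)

(** A nonzero row of the left kernel of the coefficient matrix gives the [c i]. *)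
Lemma poly_dependence (F : fieldType) m n (f : 'I_m -> {poly F}) :
  (n < m)%N -> (forall i, (size (f i) <= n)%N) ->
  exists2 c : 'I_m -> F, exists i, c i != 0 & \sum_i c i *: f i = 0.
Proof.
move=> nm sf; pose A := \matrix_(i < m) poly_rV (d := n) (f i).
have kA : kermx A != 0.
  rewrite -mxrank_eq0 mxrank_ker -lt0n subn_gt0.
  exact: leq_ltn_trans (rank_leq_col _) nm.
have [i ri] : exists i, row i (kermx A) != 0.
  apply/existsP; apply: contraNT kA => /existsPn rA; apply/eqP/row_matrixP => i.
  by rewrite row0; apply/eqP; move: (rA i); rewrite negbK.
pose r := row i (kermx A); exists (fun j => r 0 j).
  apply/existsP; apply: contraNT ri => /existsPn r0; apply/eqP/rowP => j.
  by rewrite [RHS]mxE; apply/eqP; move: (r0 j); rewrite negbK.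
have rA : r *m A = 0 by apply/sub_kermxP/row_sub.
have -> : \sum_j r 0 j *: f j = rVpoly (r *m A).
  rewrite mulmx_sum_row linear_sum; apply: eq_bigr => j _.
  by rewrite rowK linearZ /= poly_rV_K.
by rewrite rA linear0.
Qed.

Lemma size_mul_bound (R : nzSemiRingType) (a b : {poly R}) i j k :
  (size a <= i)%N -> (size b <= j)%N -> (i + j <= k.+1)%N -> (size (a * b)%R <= k)%N.
Proof. by move=> sa sb ijk; apply: leq_trans (size_polyMleq _ _) _; lia. Qed.

Lemma size_add_bound (R : nzSemiRingType) (a b : {poly R}) k :
  (size a <= k)%N -> (size b <= k)%N -> (size (a + b)%R <= k)%N.
Proof. by move=> sa sb; apply: leq_trans (size_polyD _ _) _; rewrite geq_max sa. Qed.

Lemma size_mulrn_bound (R : nzSemiRingType) (a : {poly R}) m k :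
  (size a <= k)%N -> (size (a *+ m)%R <= k)%N.
Proof.
move=> sa; elim: m => [|m IHm]; first by rewrite mulr0n size_poly0.
by rewrite mulrS size_add_bound.
Qed.

(** * Creative telescoping for rational functions *)

Section Telescoper.
Variables (F K : fieldType) (dF : F -> F) (iota : {rmorphism {poly F} -> K}).
Variables (delta partial : K -> K).
Hypotheses (char0 : forall n, n.+1%:R != 0 :> F).
Hypotheses (dP : derivation delta) (pP : derivation partial).
Hypothesis iota_eq0 : forall q, (iota q == 0) = (q == 0).
Hypothesis delta_iota : forall q, delta (iota q) = iota q^`().
Hypothesis partial_iota : forall q, partial (iota q) = iota (map_poly dF q).

Lemma lead_coef_deriv_char0 (q : {poly F}) :
  lead_coef q^`() = lead_coef q *+ (size q).-1.
Proof.
have [q1|q1] := leqP (size q) 1.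
  by rewrite (size1_polyC q1) derivC lead_coef0 lead_coefC size_polyC; case: eqP.
have [n sq] : exists n, size q = n.+2 by case: (size q) q1 => [|[|n]] // _; exists n.
have qn : q^`()`_n = lead_coef q *+ n.+1 by rewrite coef_deriv lead_coefE sq.
suff sq' : size q^`() = n.+1 by rewrite lead_coefE sq' sq.
have q0 : q != 0 by rewrite -size_poly_gt0 sq.
have sq1 : (size q^`() <= n.+1)%N by rewrite -ltnS -sq lt_size_deriv.
apply/eqP; rewrite eqn_leq sq1 /=.
rewrite ltnNge; apply/negP => sq'; move/eqP: qn; rewrite nth_default // eq_sym.
by rewrite -mulr_natr mulf_eq0 (negPf (char0 n)) orbF lead_coef_eq0 (negPf q0).
Qed.

(** Leading coefficients show that the degrees agree as elements of [F], hence as integers in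
    characteristic 0. *)
Lemma size_wronskian (q r : {poly F}) : q != 0 -> r != 0 ->
  q^`() * r = q * r^`() -> size q = size r.
Proof.
move=> q0 r0 /(congr1 lead_coef); rewrite !lead_coefM !lead_coef_deriv_char0.
rewrite mulrnAl mulrnAr => /eqP; set l := lead_coef q * lead_coef r.
rewrite -[l *+ (size q).-1]mulr_natr -[l *+ (size r).-1]mulr_natr.
have l0 : l != 0 by rewrite mulf_neq0 ?lead_coef_eq0.
rewrite (inj_eq (mulfI l0)) => /eqP e.
have injn m n : (m < n)%N -> m%:R <> n%:R :> F.
  move=> mn; rewrite -(subnKC mn) addSnnS natrD => /eqP.
  by rewrite -subr_eq0 opprD addrA subrr add0r oppr_eq0 (negPf (char0 _)).
have : (size q).-1 = (size r).-1.
  by have [/injn/(_ e)|/injn/(_ (esym e))|] := ltngtP (size q).-1 (size r).-1.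
by move: q0 r0; rewrite -!size_poly_gt0; lia.
Qed.

Section Denominator.
Variables (D P : {poly F}) (N : nat).
Hypothesis D0 : D != 0.

(** The numerator over [D^(N+1)] of [delta f + (P/D) f] at [f = q / D^N]. *)
Let L (q : {poly F}) : {poly F} := q^`() * D - q * D^`() *+ N + P * q.

Lemma fraction_numerator q : delta (iota q / iota D ^+ N) + iota P / iota D * (iota q / iota D ^+ N)
  = iota (L q) / iota D ^+ N.+1.
Proof.
have iD0 : iota D != 0 by rewrite iota_eq0.
rewrite (der_div dP) ?expf_neq0 // delta_iota.
rewrite /L !(rmorphD, rmorphN, rmorphM, rmorphMn) /=.
case: N => [|n]; first by rewrite expr0 (der1 dP) mulr0n expr1; field; rewrite iD0 oner_neq0.
rewrite (der_exp dP) delta_iota -[_ *+ n.+1]mulr_natr -[iota q * _ *+ _]mulr_natr.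
rewrite !exprS; move: (iota D ^+ n) (expf_neq0 n iD0) (n.+1%:R : K) => w w0 c.
by field; rewrite iD0 w0.
Qed.

(* Any two nonzero solutions of L q = 0 have vanishing Wronskian, hence the
   same degree. *)
Lemma numerator_pivot : exists k, forall q, L q = 0 -> q`_k = 0 -> q = 0.
Proof.
have [[r r0 Lr]|noL] := pselect (exists2 r, r != 0 & L r = 0); last first.
  exists 0%N => q Lq _; apply/eqP/negPn/negP => q0; apply: noL.
  by exists q.
exists (size r).-1 => q Lq; have [//|q0] := eqVneq q 0.
suff -> : size r = size q.
  by move/eqP; rewrite -lead_coefE lead_coef_eq0 (negPf q0).
apply: size_wronskian => //; apply: (mulIf D0); apply/eqP; rewrite -subr_eq0.
apply/eqP; transitivity (L r * q - r * L q); last by rewrite Lr Lq mul0r mulr0 subrr.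
rewrite /L; ring.
Qed.

(* The unknowns c 0, ..., c N and q_0, ..., q_(C N) outnumber the coefficients of
   the equation. Adding q`_k *: 'X^n to L q, with k the pivot and n above all
   degrees, makes L injective, so that the c i cannot all vanish. *)
Lemma telescoper_poly C (f : nat -> {poly F}) :
  (C < N)%N -> (size D <= C)%N -> (size P <= C)%N ->
  (forall i, (i <= N)%N -> (size (f i) <= (C * N.+1).+1)%N) ->
  exists2 c : nat -> F, exists2 i, (i <= N)%N & c i != 0 &
    exists q, \sum_(i < N.+1) c i *: f i = L q.
Proof.
move=> CN sD sP sf; have [k kP] := numerator_pivot.
pose n := (C * N.+1).+1; pose L' (q : {poly F}) : {poly F} := L q + q`_k *: 'X^n.
have L'D q r : L' (q + r) = L' q + L' r.
  by rewrite /L' /L coefD derivD scalerDl; ring.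
have L'0 : L' 0 = 0 by rewrite /L' /L coef0 deriv0 scale0r; ring.
have L'Z a q : L' (a *: q) = a *: L' q.
  rewrite /L' /L derivZ coefZ -scalerA -!mul_polyC; ring.
have sL (q : {poly F}) : (size q <= (C * N).+1)%N -> (size (L q) <= n)%N.
  move=> sq; have sq' : (size q^`() <= C * N)%N.
    have [->|q0] := eqVneq q 0; first by rewrite deriv0 size_poly0.
    by rewrite -ltnS; apply: leq_trans sq; apply: lt_size_deriv.
  have sD' : (size D^`() <= C)%N by apply: leq_trans sD; apply/ltnW/lt_size_deriv.
  rewrite /L; apply: size_add_bound; last by apply: size_mul_bound sP sq _; rewrite /n mulnS; lia.
  apply: size_add_bound; first by apply: size_mul_bound sq' sD _; rewrite /n mulnS; lia.
  rewrite size_polyN; apply: size_mulrn_bound.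
  by apply: size_mul_bound sq sD' _; rewrite /n mulnS; lia.
pose h (i : 'I_(N.+1 + (C * N).+1)) : {poly F} :=
  match split i with inl j => f j | inr j => L' 'X^j end.
(* [C < N] gives [C * N + N + 2 > C * N + C + 2]: more polynomials than coefficients. *)
have [||c [i0 ci0] c0] := @poly_dependence F _ n.+1 h.
- by rewrite /n; lia.
- move=> i; rewrite /h; case: (split i) => j.
    by rewrite leqW // sf // -ltnS.
  rewrite (leq_trans (size_polyD _ _)) // geq_max leqW /=; last first.
    by apply: sL; rewrite size_polyXn.
  by rewrite (leq_trans (size_scale_leq _ _)) // size_polyXn.
pose c1 (i : nat) := c (lshift _ (inord i)).
pose b (j : 'I_(C * N).+1) := c (rshift _ j).
pose q := \sum_j b j *: 'X^j.
have cq : \sum_(i < N.+1) c1 i *: f i + L' q = 0.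
  rewrite -[RHS]c0 big_split_ord /=; congr (_ + _).
    apply: eq_bigr => i _; rewrite /c1 /h inord_val.
    case: splitP => j /= e; first by rewrite e.
    by have := ltn_ord i; rewrite e; lia.
  rewrite (big_morph L' L'D L'0); apply: eq_bigr => j _.
  rewrite L'Z /h; case: splitP => j' /= e; last first.
    by have -> : j = j' by apply/val_inj/(addnI e).
  by have := ltn_ord j'; rewrite -e; lia.
have qj (j : 'I_(C * N).+1) : q`_j = b j.
  rewrite coef_sum (bigD1 j) //= coefZ coefXn eqxx mulr1 big1 ?addr0 // => l lj.
  by rewrite coefZ coefXn eq_sym (negPf (_ : val l != val j)) ?mulr0.
have sq : (size q <= (C * N).+1)%N.
  by rewrite (leq_trans (size_sum _ _ _)) //; apply/bigmax_leqP => j _;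
     rewrite (leq_trans (size_scale_leq _ _)) // size_polyXn.
(* The [f i] and [L q] have size at most [n], so the coefficient of [X^n] isolates [q_k]. *)
have qk : q`_k = 0.
  have := congr1 (fun r : {poly F} => r`_n) cq.
  rewrite /= coef0 coefD coefD coefZ coefXn eqxx mulr1 coef_sum big1 => [|i _].
    by rewrite add0r nth_default ?sL // add0r.
  by rewrite coefZ nth_default ?mulr0 // sf // -ltnS.
have Lq : \sum_(i < N.+1) c1 i *: f i = L (- q).
  have LN : L (- q) = - L q by rewrite /L derivN; ring.
  by apply/eqP; rewrite LN -addr_eq0; move/eqP: cq; rewrite /L' qk scale0r addr0.
exists c1; last by exists (- q).
(* If all [c1 i] vanish, then [L q = 0] and [q_k = 0]; the pivot gives [q = 0], and the whole
   dependence is trivial. *)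
apply: contrapT => c10; have {}c10 (i : 'I_N.+1) : c1 i = 0.
  apply/eqP/negPn/negP => ci; apply: c10; exists i => //; by rewrite -ltnS.
have q0 : q = 0.
  apply: kP => //; apply/eqP; rewrite -oppr_eq0; apply/eqP.
  have LN : L (- q) = - L q by rewrite /L derivN; ring.
  by rewrite -LN -Lq big1 // => i _; rewrite c10 scale0r.
move/eqP: ci0; apply; rewrite -(splitK i0); case: (split i0) => j /=.
  by have := c10 j; rewrite /c1 inord_val.
by have := qj j; rewrite q0 coef0 /b => <-.
Qed.
End Denominator.

(** This is [(partial + a)^n] applied to [b]. If [partial w = a w], then [partial^n (b w)] is its
    product with [w]. *)
Fixpoint twisted_iter (a b : K) n : K :=
  if n is m.+1 then partial (twisted_iter a b m) + a * twisted_iter a b m else b.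

Hypothesis iota_frac : forall x, exists n d : {poly F}, d != 0 /\ x = iota n / iota d.

Lemma common_denominator x y z : exists A B C D : {poly F},
  [/\ D != 0, x = iota A / iota D, y = iota B / iota D & z = iota C / iota D].
Proof.
have [a [a' [a0 ->]]] := iota_frac x; have [b [b' [b0 ->]]] := iota_frac y.
have [c [c' [c0 ->]]] := iota_frac z.
exists (a * b' * c'), (b * a' * c'), (c * a' * b'), (a' * b' * c').
have ia : iota a' != 0 by rewrite iota_eq0.
have ib : iota b' != 0 by rewrite iota_eq0.
have ic : iota c' != 0 by rewrite iota_eq0.
by rewrite !mulf_neq0 // !rmorphM /=; split=> //; field; rewrite ia ib ic.
Qed.

(** Over a common denominator [D], the [i]-th twisted derivative has denominator [D^(i+1)] and a
    numerator whose degree bound is linear in [i], as [telescoper_poly] requires. Dividing by the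
    last nonzero coefficient makes the operator monic. *)
Lemma telescoper (p a b : K) : exists n (c : nat -> F) g,
  twisted_iter a b n + \sum_(i < n) iota (c i)%:P * twisted_iter a b i
    = delta g + p * g.
Proof.
have [A [P [B [D [D0 -> -> ->]]]]] := common_denominator a p b.
have iD0 : iota D != 0 by rewrite iota_eq0.
set t := twisted_iter _ _.
pose al := fix al n := if n is m.+1 then
  map_poly dF (al m) * D - al m * map_poly dF D *+ m.+1 + A * al m else B.
have tal i : t i = iota (al i) / iota D ^+ i.+1.
  elim: i => [|i IHi]; first by rewrite expr1.
  rewrite /t /= -/t IHi (der_div pP) ?expf_neq0 // (der_exp pP) !partial_iota.
  rewrite !(rmorphD, rmorphN, rmorphM, rmorphMn) /=.
  rewrite -[_ * _ *+ _ in LHS]mulr_natr -[_ * _ *+ _ in RHS]mulr_natr.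
  rewrite !exprS; move: (iota D ^+ i) (expf_neq0 i iD0) (i.+1%:R : K) => w w0 c.
  by field; rewrite iD0 w0.
have [C [sA sP sB sD]] : exists C,
    [/\ size A <= C, size P <= C, size B <= C & size D <= C]%N.
  by exists (size A + size P + size B + size D)%N; split; lia.
pose N := C.+1.
have sal i : (size (al i) <= (C * i.+1).+1)%N.
  elim: i => [|i IHi] /=; first by rewrite muln1 leqW.
  have sm (q : {poly F}) : (size (map_poly dF q) <= size q)%N by apply: size_poly.
  apply: size_add_bound; last by apply: size_mul_bound sA IHi _; rewrite [(C * i.+2)%N]mulnS; lia.
  apply: size_add_bound; last rewrite size_polyN; last apply: size_mulrn_bound.
    by apply: size_mul_bound (leq_trans (sm _) IHi) sD _; rewrite [(C * i.+2)%N]mulnS; lia.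
  by apply: size_mul_bound IHi (leq_trans (sm _) sD) _; rewrite [(C * i.+2)%N]mulnS; lia.
(* The factor [D ^+ (N - i)] puts all terms over [D^(N+1)]. *)
have [||||c [i0 i0N ci0] [q cq]] := @telescoper_poly D P N D0 C (fun i => al i * D ^+ (N - i)).
- by [].
- exact: sD.
- exact: sP.
- move=> i iN; rewrite (leq_trans (size_polyMleq _ _)) //.
  have := size_poly_exp_leq D (N - i); have := sal i.
  have : ((size D).-1 * (N - i) <= C * (N - i))%N by rewrite leq_mul2r; apply/orP; right; lia.
  have -> : (C * N.+1 = C * i.+1 + C * (N - i))%N by rewrite -mulnDr addSn subnKC.
  lia.
have [n /andP[nN cn] nmax] : exists2 n, (n <= N)%N && (c n != 0) &
    forall j, (j <= N)%N && (c j != 0) -> (j <= n)%N.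
  have ex : exists n, (n <= N)%N && (c n != 0) by exists i0; rewrite i0N.
  have ub n : (n <= N)%N && (c n != 0) -> (n <= N)%N by case/andP.
  by case: (ex_maxnP ex ub) => n; exists n.
have icn : iota (c n)%:P != 0 by rewrite iota_eq0 polyC_eq0.
exists n, (fun i => c i / c n), (iota q / iota D ^+ N / iota (c n)%:P).
have dcn : delta (iota (c n)%:P) = 0 by rewrite delta_iota derivC rmorph0.
rewrite (der_div dP) // dcn mulr0 subr0.
have := fraction_numerator P N D0 q; rewrite -cq => e.
transitivity ((delta (iota q / iota D ^+ N) +
    iota P / iota D * (iota q / iota D ^+ N)) / iota (c n)%:P); last first.
  by move: (delta _) => w; field; rewrite icn iD0 expf_neq0.
rewrite e rmorph_sum /= mulr_suml mulr_suml.
have -> : \sum_(i < N.+1) iota (c i *: (al i * D ^+ (N - i))) / iota D ^+ N.+1 / iota (c n)%:P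
   = \sum_(i < N.+1) iota (c i / c n)%:P * t i.
  apply: eq_bigr => i _; rewrite tal -mul_polyC !rmorphM rmorphXn /=.
  have -> : iota (c n)^-1%:P = (iota (c n)%:P)^-1.
    by apply: (mulfI icn); rewrite divff // -rmorphM -polyCM divff // polyC1 rmorph1.
  have -> : iota D ^+ N.+1 = iota D ^+ (N - i) * iota D ^+ i.+1.
    by rewrite -exprD addnS subnK // -ltnS.
  have := expf_neq0 (N - i) iD0; have := expf_neq0 i.+1 iD0.
  by move: (iota D ^+ _) (iota D ^+ _) => w w' w0 w0'; field; rewrite w0 w0' icn.
pose G i := iota (c i / c n)%:P * t i.
transitivity (\sum_(i < n.+1) G i).
  by rewrite big_ord_recr addrC /G /= divff // polyC1 rmorph1 mul1r.
rewrite -(big_mkord xpredT G) -[RHS](big_mkord xpredT G).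
rewrite [RHS](@big_cat_nat _ _ _ n.+1) //= [X in _ + X]big_nat [X in _ + X]big1 ?addr0 //.
move=> i /andP[ni iN]; rewrite /G; have [->|ci] := eqVneq (c i) 0.
  by rewrite mul0r polyC0 rmorph0 mul0r.
by have := nmax i; rewrite -ltnS iN ci leqNgt ni => /(_ isT).
Qed.
End Telescoper.

(** * Failure of (1) or (2) yields a differential relation for [eta] *)

Section Dependence.
Variables (M : fieldType) (d D : M -> M) (K : divringClosed M).
Hypotheses (dP : derivation d) (DP : derivation D).
Hypothesis dD : forall m, d (D m) = D (d m).
Hypothesis DK : {homo D : x / x \in K}.
Hypothesis cK : forall c, d c = 0 -> c \in K.
Hypothesis telescope : forall p a b, p \in K -> a \in K -> b \in K ->
  exists n (c : nat -> M) g, [/\ forall i, d (c i) = 0, g \in K &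
    twisted_iter D a b n + \sum_(i < n) c i * twisted_iter D a b i = d g + p * g].
Variables (p eta : M).
Hypotheses (pK : p \in K) (dd_eta : d (d eta) = p * d eta) (u0 : d eta != 0).

Let u := d eta.
Let v := D u / u.
Let y i := iter i D eta.
(** [A n] is the field [K(eta, D eta, ..., D^(n-1) eta)], so [y n] in [A n] is a relation of order
    [n], solved for the last derivative. *)
Let A := adjoin_seq K y.

Let dv : d v = D p. Proof. exact: der_logder dd_eta u0. Qed.

Lemma sub_tower n : {subset K <= A n}.
Proof. exact: sub_base_adjoin_seq. Qed.

Lemma gen_tower i n : (i < n)%N -> y i \in A n.
Proof. exact: adjoin_seq_gen. Qed.

Lemma der_tower n x : x \in A n -> D x \in A n.+1.
Proof.
elim: n x => [|n IHn] x xA; first by apply: sub_tower; apply: DK.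
move: x xA; apply: (@adjoin_der_sub _ (A n) (y n) D (A n.+2)) => //.
- by move=> z /IHn; apply: sub_adjoin.
- exact: (@sub_adjoin_seq _ K y n.+1 n.+2 (leqnSn _)).
- exact: (@gen_tower n.+1).
Qed.

Lemma combination_mem n (c : nat -> M) (S : divringClosed M) (x : nat -> M) :
  {subset K <= S} -> (forall i, d (c i) = 0) -> (forall i, (i < n)%N -> x i \in S) ->
  \sum_(i < n) c i * x i \in S.
Proof.
move=> KS dc xS; apply: rpred_sum => i _; rewrite rpredM ?xS //.
exact/KS/cK.
Qed.

(** Here [v] lies in [K], so each [D^i u] lies in [K u]. Telescoping with [a = v] and [b = 1] makes
    a monic constant combination of the [D^i u] equal to [d (g u)]. *)
Lemma log_dependent Y : Y \in K -> d Y = D p -> exists n, y n \in A n.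
Proof.
move=> YK dY.
have aK : v \in K.
  rewrite -[v](subrK Y) rpredD //; apply: cK.
  by rewrite (derB dP) dv dY subrr.
have tu i : iter i D u = twisted_iter D v 1 i * u.
  elim: i => /= [|i ->]; first by rewrite mul1r.
  by rewrite (derM DP) mulrDl /v; field.
have [n [c [g [dc gK e]]]] := telescope pK aK (rpred1 K).
pose s := \sum_(i < n) c i * y i.
have sA : s \in A n by apply: combination_mem => // [|i]; [exact: sub_tower | exact: gen_tower].
pose k := y n + s - g * u.
have kK : k \in K.
  apply: cK; rewrite (derB dP) (derD dP) (derM dP) dd_eta -/u.
  rewrite (der_iter dD) tu (der_sum dP).
  under eq_bigr => i _ do rewrite (derM dP) dc mul0r add0r (der_iter dD) tu mulrA.
  rewrite -mulr_suml -mulrDl e; ring.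
have [h hK Dgu] : exists2 h, h \in K & D (g * u) = h * (g * u).
  have [->|g0] := eqVneq g 0.
    by exists 0; rewrite ?rpred0 // !mul0r der0.
  exists (D g / g + v); first by rewrite rpredD // rpred_div // DK.
  by rewrite (derM DP) /v; field; rewrite g0 u0.
(* Applying [D] to [y n + s = g * u + k] and eliminating [g * u] removes [u], which is not known to
   lie in the tower. *)
exists n.+1; have -> : y n.+1 = h * (y n + s - k) + D k - D s.
  have -> : y n + s - k = g * u by rewrite /k; ring.
  by rewrite -Dgu /k (derB DP) (derD DP) /y /=; ring.
have sA' : s \in A n.+1 by apply: sub_adjoin_seq sA.
have [hA kA DkA] : [/\ h \in A n.+1, k \in A n.+1 & D k \in A n.+1].
  by split; apply: sub_tower => //; apply: DK.
apply: rpredB; last exact: der_tower.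
apply: rpredD DkA; apply: rpredM hA _; apply: rpredB kA; apply: rpredD sA'.
exact: gen_tower.
Qed.

(** [w = Y u] differs from [eta] by a constant, so the derivatives of [w] and [eta] agree modulo
    [K]. A monic operator with constant coefficients sends [D w / w] into [K], which is a relation
    for [w]. *)
Lemma exp_dependent Y : Y \in K -> d Y + p * Y = 1 -> exists n, y n \in A n.
Proof.
move=> YK dY; pose w := Y * u.
have Y0 : Y != 0.
  apply: contra_eq_neq dY => ->.
  by rewrite (der0 dP) mulr0 addr0 eq_sym oner_neq0.
have w0 : w != 0 by rewrite mulf_neq0.
have kK : eta - w \in K.
  apply: cK; rewrite (derB dP) (derM dP) dd_eta -/u -{1}[u]mul1r -dY; ring.
have KwA i x : x \in K -> iter i D x \in K by move=> xK; elim: i => //= i; apply: DK.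
have wy i : iter i D w = y i - iter i D (eta - w).
  by apply: (canRL (addrK _)); rewrite -(der_iterD DP) addrC subrK.
have wA i n : (i < n)%N -> iter i D w \in A n.
  by move=> ij; rewrite wy rpredB ?gen_tower //; apply/sub_tower/KwA.
pose t := D w / w.
have tv : t = v + D Y / Y.
  by rewrite /t /w (derM DP) /v; field; rewrite u0 Y0.
(* With [p = 0] and [a = 0], a constant combination of the plain derivatives of [D p] becomes
   [d g]. *)
have [n [c [g [dc gK]]]] := telescope (rpred0 K) (rpred0 K) (DK pK).
have tw i : twisted_iter D 0 (D p) i = iter i D (D p).
  by elim: i => //= i ->; rewrite mul0r addr0.
rewrite tw mul0r addr0; under eq_bigr => i _ do rewrite tw.
move=> e.
pose k x := iter n D x + \sum_(i < n) c i * iter i D x.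
have kD x z : k (x + z) = k x + k z.
  rewrite /k (der_iterD DP) -!addrA; congr (_ + _); rewrite addrCA; congr (_ + _).
  by rewrite -big_split; apply: eq_bigr => i _; rewrite (der_iterD DP) mulrDr.
have kxK x : x \in K -> k x \in K.
  move=> xK; rewrite rpredD ?KwA // combination_mem // => i _; exact: KwA.
have ktK : k t \in K.
  rewrite tv kD rpredD //; last by rewrite kxK // rpred_div // DK.
  (* [k v] and [g] have the same [d]-derivative, hence differ by a constant. *)
  rewrite -[k v](subrK g) rpredD //; apply: cK.
  rewrite (derB dP) (derD dP) (der_sum dP) (der_iter dD) dv -e; apply/eqP; rewrite subr_eq0.
  apply/eqP; congr (_ + _); apply: eq_bigr => i _.
  by rewrite (derM dP) dc mul0r add0r (der_iter dD) dv.
(* t_i = D^i t agrees with D^(i+1) w / w up to lower order derivatives of w. *)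
have tA i : iter i.+1 D w - w * iter i D t \in A i.+1 /\ iter i D t \in A i.+2.
  have tP j : iter j.+1 D w - w * iter j D t \in A j.+1 -> iter j D t \in A j.+2.
    move=> qA; have -> : iter j D t = (iter j.+1 D w - (iter j.+1 D w - w * iter j D t)) / w.
      by field.
    rewrite rpred_div ?(wA 0) // rpredB ?wA //.
    exact: (@sub_adjoin_seq _ _ _ j.+1).
  suff qA : iter i.+1 D w - w * iter i D t \in A i.+1 by split=> //; apply: tP.
  elim: i => [|i IHi].
    by rewrite /= /t mulrCA divff // mulr1 subrr rpred0.
  have -> : iter i.+2 D w - w * iter i.+1 D t =
      D (iter i.+1 D w - w * iter i D t) + D w * iter i D t.
    by rewrite (derB DP) (derM DP) /=; ring.
  by rewrite rpredD ?der_tower // rpredM ?tP // (wA 1).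
(* Modulo [A n.+1], [D^(n+1) w] equals [w * D^n t]. As [k t] is in [K], [D^n t] is expressed by the
   lower [D^i t], which lie in [A n.+1]. *)
exists n.+1; rewrite -[y n.+1](subrK (iter n.+1 D (eta - w))) -wy.
rewrite rpredD //; last exact/sub_tower/KwA.
rewrite -[iter n.+1 D w](subrK (w * iter n D t)) rpredD ?(tA n).1 //.
rewrite rpredM ?(wA 0) //.
have -> : iter n D t = k t - \sum_(i < n) c i * iter i D t by rewrite /k addrK.
apply: rpredB; first exact: sub_tower.
apply: (@combination_mem n c (A n.+1)) => //; first exact: sub_tower.
by move=> i ij; apply: sub_adjoin_seq (tA i).2.
Qed.
End Dependence.

(** * Polynomial and rational expressions in finitely many generators *)

Section MonomialSpan.
Variables (L M : fieldType) (phi : {rmorphism L -> M}) (y : nat -> M).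

(** Exponents may repeat in the list, so that a sum is a concatenation; [mspan_uniq] collects
    them. *)
Definition mspan n (z : M) := exists l : seq (L * n.-tuple nat),
  z = \sum_(x <- l) phi x.1 * monomial y x.2.

Lemma mspan_scalar n a : mspan n (phi a).
Proof.
exists [:: (a, [tuple 0%N | i < n])]; rewrite big_seq1 /monomial big1 ?mulr1 //.
by move=> i _; rewrite tnth_mktuple.
Qed.

Lemma mspan_gen i n : (i < n)%N -> mspan n (y i).
Proof.
move=> ij; exists [:: (1, [tuple nat_of_bool (val j == i) | j < n])].
rewrite big_seq1 rmorph1 mul1r /monomial (bigD1 (Ordinal ij)) //=.
rewrite tnth_mktuple eqxx expr1 big1 ?mulr1 // => j ji.
by move: ji; rewrite tnth_mktuple -val_eqE /= => /negPf ->.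
Qed.

Lemma mspanD n a b : mspan n a -> mspan n b -> mspan n (a + b).
Proof. by move=> [l ->] [k ->]; exists (l ++ k); rewrite big_cat. Qed.

Lemma mspanM n a b : mspan n a -> mspan n b -> mspan n (a * b).
Proof.
move=> [l ->] [k ->].
exists [seq (x.1 * z.1, [tuple tnth x.2 i + tnth z.2 i | i < n]%N) | x <- l, z <- k].
rewrite big_allpairs_dep /= mulr_suml; apply: eq_bigr => x _.
rewrite mulr_sumr; apply: eq_bigr => z _; rewrite rmorphM mulrACA; congr (_ * _).
by rewrite -big_split; apply: eq_bigr => i _; rewrite tnth_mktuple exprD.
Qed.

Lemma mspanN n a : mspan n a -> mspan n (- a).
Proof.
by move=> /(mspanM (mspan_scalar n (- 1))); rewrite rmorphN1 mulN1r.
Qed.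

Lemma mspan_uniq n z : mspan n z -> exists s (c : n.-tuple nat -> L),
  uniq s /\ z = \sum_(e <- s) phi (c e) * monomial y e.
Proof.
move=> [l ->]; exists (undup [seq x.2 | x <- l]), (fun e => \sum_(x <- l | x.2 == e) x.1).
split; first exact: undup_uniq.
under [RHS]eq_bigr => e _ do rewrite rmorph_sum mulr_suml.
rewrite (exchange_big_dep xpredT) //= big_seq [RHS]big_seq; apply: eq_bigr => x xl.
under eq_bigl do rewrite eq_sym.
have x2 : x.2 \in undup [seq x.2 | x <- l] by rewrite mem_undup map_f.
by rewrite -big_filter (filter_pred1_uniq (undup_uniq _) x2) big_seq1.
Qed.

Definition mfrac n : {pred M} := [pred z | `[< exists a b,
  [/\ mspan n a, mspan n b, b != 0 & z = a / b] >]].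

Lemma mfrac_divring_closed n : GRing.divring_closed (mfrac n).
Proof.
have mspan1 : mspan n 1 by rewrite -(rmorph1 phi); apply: mspan_scalar.
split.
- by apply/asboolP; exists 1, 1; rewrite oner_neq0 divr1.
- move=> _ _ /asboolP[a [b [a_ b_ b0 ->]]] /asboolP[c [e [c_ e_ e0 ->]]].
  apply/asboolP; exists (a * e - c * b), (b * e); split; last by field; rewrite b0 e0.
  + by apply: mspanD; [|apply: mspanN]; apply: mspanM.
  + exact: mspanM.
  + exact: mulf_neq0.
- move=> _ _ /asboolP[a [b [a_ b_ b0 ->]]] /asboolP[c [e [c_ e_ e0 ->]]].
  apply/asboolP; have [c0|c0] := eqVneq c 0.
    exists (phi 0), 1; split=> //; [exact: mspan_scalar | exact: oner_neq0 |].
    by rewrite c0 rmorph0 !mul0r invr0 mulr0.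
  exists (a * e), (b * c); split; last by field; rewrite b0 c0 e0.
  + exact: mspanM.
  + exact: mspanM.
  + exact: mulf_neq0.
Qed.

HB.instance Definition _ n :=
  GRing.isDivringClosed.Build M (mfrac n) (mfrac_divring_closed n).

Lemma mspan_mfrac n z : mspan n z -> z \in mfrac n.
Proof.
move=> z_; apply/asboolP; exists z, 1; rewrite oner_neq0 divr1; split=> //.
by rewrite -(rmorph1 phi); apply: mspan_scalar.
Qed.

(** Clear the denominator in [y n = a / b]: the relation [b * y n - a = 0] has a nonzero coefficient
    because [b] is nonzero. *)
Lemma mfrac_relation n : y n \in mfrac n ->
  exists (s : seq (n.+1.-tuple nat)) c, [/\ uniq s,
    \sum_(e <- s) phi (c e) * monomial y e = 0 & exists2 e, e \in s & c e != 0].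
Proof.
move=> /asboolP[a [b [/mspan_uniq[sa [ca [ua ea]]] /mspan_uniq[sb [cb [ub eb]]] b0 yab]]].
pose ext j (e : n.-tuple nat) : n.+1.-tuple nat := [tuple of rcons e j].
have ext_inj j : injective (ext j).
  by move=> e f /(congr1 val) /= /rcons_inj[/val_inj].
pose top (e : n.+1.-tuple nat) := last 0%N e.
have top_ext j e : top (ext j e) = j by rewrite /top /= last_rcons.
pose init (e : n.+1.-tuple nat) := [tuple tnth e (widen_ord (leqnSn n) i) | i < n].
have init_ext j e : init (ext j e) = e.
  apply: eq_from_tnth => i; rewrite tnth_mktuple !(tnth_nth 0%N) /= nth_rcons.
  by rewrite size_tuple ltn_ord.
(* The last exponent is 1 in the terms of [b * y n] and 0 in those of [a], so the two lists are
   disjoint. *)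
exists ([seq ext 1%N e | e <- sb] ++ [seq ext 0%N e | e <- sa]).
exists (fun e => if top e == 1%N then cb (init e) else - ca (init e)); split.
- rewrite cat_uniq !map_inj_uniq // ub ua andbT; apply/hasPn => e /mapP[f _ ->].
  by apply/mapP => -[g _] /(congr1 top); rewrite !top_ext.
- transitivity (b * y n - a); last by rewrite yab mulrCA divff // mulr1 subrr.
  rewrite big_cat !big_map {1}eb {1}ea mulr_suml -sumrN.
  congr (_ + _); apply: eq_bigr => e _; rewrite top_ext /= init_ext monomial_rcons.
    by rewrite expr1 mulrA.
  by rewrite expr0 mulr1 rmorphN mulNr.
- have [e es ce] : exists2 e, e \in sb & cb e != 0.
    apply: contrapT => nb; case/eqP: b0; rewrite eb big_seq big1 // => e es.
    have [->|ce] := eqVneq (cb e) 0; first by rewrite rmorph0 mul0r.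
    by case: nb; exists e.
  exists (ext 1%N e); first by rewrite mem_cat map_f.
  by rewrite top_ext init_ext.
Qed.
End MonomialSpan.

Lemma quotient_rule_cancel (L : fieldType) (a a' b b' : L) : b != 0 ->
  ((a' * b + a * b') * b - a * b * b') / b ^+ 2 = a'.
Proof. by move=> b0; field. Qed.

(** * The two derivations on rational functions *)

Section RationalFunctions.
Local Notation "x %:F" := (@FracField.tofrac _ x).

Lemma fracE (R : idomainType) (x : {fraction R}) :
  x = (\n_(repr x))%:F / (\d_(repr x))%:F.
Proof.
have d0 : (\d_(repr x))%:F != 0 by rewrite tofrac_eq0 denom_ratioP.
apply: (canRL (mulfK d0)).
rewrite -{1}[x]reprK; move: (repr x) => r; unlock FracField.tofrac.
rewrite -[LHS]FracField.pi_mul; apply/eqmodP => /=.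
rewrite FracField.equivfE /FracField.mulf !numden_Ratio ?oner_neq0 ?mulr1 //.
- by rewrite mulrC.
- exact: denom_ratioP.
- exact: denom_ratioP.
Qed.

(** The chosen representative of [q] may have a denominator other than 1; its numerator is then [q]
    times that denominator. *)
Lemma numer_tofrac (R : idomainType) (q : R) :
  \n_(repr q%:F) = q * \d_(repr q%:F).
Proof.
apply/eqP; rewrite -tofrac_eq tofracM {2}[q%:F]fracE divfK //.
by rewrite tofrac_eq0 denom_ratioP.
Qed.

Variables (F : fieldType) (dF : F -> F).
Hypothesis dF_der : derivation dF.

Lemma map_derivation_mul (q r : {poly F}) :
  map_poly dF (q * r) = map_poly dF q * r + q * map_poly dF r.
Proof.
apply/polyP => i; rewrite coefD (coef_map_der dF_der) !coefM (der_sum dF_der) -big_split.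
by apply: eq_bigr => j _; rewrite derM // !coef_map_der.
Qed.

Lemma deltaK_tofrac (q : {poly F}) : deltaK q%:F = q^`()%:F.
Proof.
rewrite /deltaK numer_tofrac; have := denom_ratioP (repr q%:F).
move: (\d_(repr q%:F)) => d d0; rewrite derivM tofracM tofracD !tofracM.
by rewrite quotient_rule_cancel // tofrac_eq0.
Qed.

Lemma partialK_tofrac (q : {poly F}) : partialK dF q%:F = (map_poly dF q)%:F.
Proof.
rewrite /partialK numer_tofrac.
have := denom_ratioP (repr q%:F); move: (\d_(repr q%:F)) => d d0.
rewrite -!/(map_poly dF _) map_derivation_mul tofracM tofracD !tofracM.
by rewrite quotient_rule_cancel // tofrac_eq0.
Qed.
End RationalFunctions.

(** * The image of [F(x)] in [M], and the equivalence *)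

Definition morph_image (L M : fieldType) (phi : {rmorphism L -> M}) : {pred M} :=
  [pred z | `[< exists f, z = phi f >]].

Lemma morph_image_divring_closed (L M : fieldType) (phi : {rmorphism L -> M}) :
  GRing.divring_closed (morph_image phi).
Proof.
split; first by apply/asboolP; exists 1; rewrite rmorph1.
- move=> _ _ /asboolP[f ->] /asboolP[g ->]; apply/asboolP; exists (f - g).
  by rewrite rmorphB.
- move=> _ _ /asboolP[f ->] /asboolP[g ->]; apply/asboolP; exists (f / g).
  by rewrite fmorph_div.
Qed.

HB.instance Definition _ (L M : fieldType) (phi : {rmorphism L -> M}) :=
  GRing.isDivringClosed.Build M (morph_image phi) (morph_image_divring_closed phi).

Lemma mem_morph_image (L M : fieldType) (phi : {rmorphism L -> M}) f :
  phi f \in morph_image phi.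
Proof. by apply/asboolP; exists f. Qed.

(** [deltaK] and [partialK] are defined by representatives; their derivation laws are read off in
    [M] through the injective [phi]. *)
Lemma derivation_pullback (L M : fieldType) (phi : {rmorphism L -> M})
  (dL : L -> L) (d : M -> M) : derivation d ->
  (forall f, phi (dL f) = d (phi f)) -> derivation dL.
Proof.
move=> [dD dM] dphi; split=> a b; apply: (fmorph_inj phi).
  by rewrite rmorphD !dphi rmorphD dD.
by rewrite rmorphD !rmorphM !dphi rmorphM dM.
Qed.

Lemma adjoin_seq_mfrac (L M : fieldType) (phi : {rmorphism L -> M}) y m n :
  (m <= n)%N -> {subset adjoin_seq (morph_image phi) y m <= mfrac phi y n}.
Proof.
elim: m => [_ _ /asboolP[f ->]|m IHm mn] /=.
  exact/mspan_mfrac/mspan_scalar.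
apply: adjoin_min; first exact/IHm/ltnW.
exact/mspan_mfrac/mspan_gen.
Qed.

Theorem theorem3p2
  (F : fieldType) (dF : F -> F)
  (charF : [pchar F] =i pred0)
  (dF_der : derivation dF)
  (F_closed : diff_closed dF)
  (p : ratfun F)
  (M : fieldType) (dM pM : M -> M) (phi : {rmorphism ratfun F -> M})
  (HM : Delta_ext dF dM pM phi)
  (HPPV : is_PPV_ext dF dM pM phi p)
  (eta : M)
  (Heta : dM (dM eta) = phi p * dM eta)
  (Heta' : dM eta != 0) :
  partial_transcendental pM phi eta <->
  ((~ exists Y : ratfun F, deltaK Y = partialK dF p) /\
   (~ exists Y : ratfun F, deltaK Y + p * Y = 1)).
Proof.
have [dMP pMP dpM phi_delta phi_partial] := HM.
have [_ [_ [_ _ _ constM]]] := HPPV.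
have char0F n : n.+1%:R != 0 :> F by move/pcharf0P: charF => ->.
have char0 n : n.+1%:R != 0 :> M.
  rewrite -(rmorph_nat phi) fmorph_eq0 -(rmorph_nat (@FracField.tofrac {poly F})).
  by rewrite tofrac_eq0 -polyC_natr polyC_eq0.
pose K : divringClosed M := morph_image phi.
have KP z : z \in K -> exists f, z = phi f by move/asboolP.
have dK : {homo dM : x / x \in K}.
  by move=> _ /KP[f ->]; rewrite -phi_delta mem_morph_image.
have pK : {homo pM : x / x \in K}.
  by move=> _ /KP[f ->]; rewrite -phi_partial mem_morph_image.
have cK c : dM c = 0 -> c \in K by move/constM => [f [_ ->]]; apply: mem_morph_image.
(* Telescoping takes place in [F(x)] and is transported along [phi]; its coefficients come from [F],
   so [dM] kills their images. *)
have telescope q a b : q \in K -> a \in K -> b \in K ->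
    exists n (c : nat -> M) g, [/\ forall i, dM (c i) = 0, g \in K &
      twisted_iter pM a b n + \sum_(i < n) c i * twisted_iter pM a b i = dM g + q * g].
  move=> /KP[q' ->] /KP[a' ->] /KP[b' ->].
  have [n [c [g e]]] := telescoper (iota := @FracField.tofrac {poly F}) char0F
    (derivation_pullback dMP phi_delta) (derivation_pullback pMP phi_partial)
    (@tofrac_eq0 _) (@deltaK_tofrac F) (partialK_tofrac dF_der)
    (fun x => ex_intro _ _ (ex_intro _ _ (conj (denom_ratioP _) (fracE x)))) q' a' b'.
  exists n, (fun i => phi (FracField.tofrac (c i)%:P)), (phi g).
  split=> [i||]; [|exact: mem_morph_image|].
    by rewrite -phi_delta deltaK_tofrac derivC !rmorph0.
  have tw i : twisted_iter pM (phi a') (phi b') i = phi (twisted_iter (partialK dF) a' b' i).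
    elim: i => // i IHi.
    transitivity (pM (twisted_iter pM (phi a') (phi b') i) +
      phi a' * twisted_iter pM (phi a') (phi b') i); first by [].
    by rewrite IHi -phi_partial -rmorphM -rmorphD.
  rewrite tw; under eq_bigr => i _ do rewrite tw -rmorphM.
  by rewrite -rmorph_sum -rmorphD e -phi_delta -rmorphM -rmorphD.
split=> [free|[no_log no_exp] n s c us s0 e es].
  (* Membership, cleared of denominators, is a polynomial relation with a nonzero coefficient. *)
  have indep n : iter n pM eta \notin adjoin_seq K (fun i => iter i pM eta) n.
    apply/negP => /(adjoin_seq_mfrac (leqnn n))/mfrac_relation[s [c [us s0 [e es]]]].
    by rewrite (free _ s c us s0 e es) eqxx.
  split=> -[Y eY].
    have [|n] := log_dependent dMP pMP dpM pK cK telescope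
      (mem_morph_image phi p) Heta Heta' (mem_morph_image phi Y).
      by rewrite -phi_delta eY phi_partial.
    exact/negP.
  have [|n] := exp_dependent dMP pMP dpM pK cK telescope
      (mem_morph_image phi p) Heta Heta' (mem_morph_image phi Y).
    by rewrite -phi_delta -rmorphM -rmorphD eY rmorph1.
  exact/negP.
apply/eqP; rewrite -(fmorph_eq0 phi); apply/eqP.
apply: (derivatives_free dMP pMP dpM char0 dK pK cK (mem_morph_image phi p)
  Heta Heta' _ _ us _ s0) => //.
- move=> _ /KP[f ->]; rewrite -phi_delta -phi_partial; apply: contra_notN no_log.
  by move=> /eqP/fmorph_inj; exists f.
- move=> _ /KP[f ->]; rewrite -phi_delta -rmorphM -rmorphD -(rmorph1 phi).
  by apply: contra_notN no_exp => /eqP/fmorph_inj; exists f.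
- by move=> f; apply: mem_morph_image.
Qed.
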